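(* Let $(\mathbf{B},\|\cdot\|)$ be a real separable Banach space. Let $\{a_n;\ n\ge 1\}$ and $\{b_n;\ n\ge 1\}$ be increasing sequences of positive real numbers such that $\lim_{n\to\infty}a_n=\infty$ and $\{b_n/a_n;\ n\ge 1\}$ is a nondecreasing sequence. Suppose that, for every sequence $\{X,X_n;\ n\ge 1\}$ of i.i.d. symmetric $\mathbf{B}$-valued random variables, $$\frac{\sum_{i=1}^n X_i}{a_n}\to_{\mathbb{P}}0\quad\text{if and only if}\quad \lim_{n\to\infty}n\,\mathbb{P}(\|X\|>a_n)=0.$$ Then, for every sequence $\{X,X_n;\ n\ge 1\}$ of i.i.d. $\mathbf{B}$-valued random variables, writing $S_n=\sum_{i=1}^n X_i$ and $\gamma_n=n\,\mathbb{E}\left(X I\{\|X\|\le b_n\}\right)$ for $n\ge 1$, the following hold: (a) if $\lim_{n\to\infty}n\,\mathbb{P}(\|X\|>b_n)=0$, then $\dfrac{S_n-\gamma_n}{b_n}\to_{\mathbb{P}}0$; (b) if $\limsup_{n\to\infty}n\,\mathbb{P}(\|X\|>b_n)>0$, then $\limsup_{n\to\infty}\mathbb{P}\left(\dfrac{\|S_n-\gamma_n\|}{b_n}>\lambda\right)>0$ for all $\lambda>0$.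
   Context: A $\mathbf{B}$-valued random variable is a measurable function from a probability space $(\Omega,\mathcal{F},\mathbb{P})$ into $\mathbf{B}$ with its Borel $\sigma$-algebra; it is symmetric if $X$ and $-X$ have the same distribution. The notation $\{X,X_n;\ n\ge1\}$ i.i.d. means that $X,X_1,X_2,\dots$ are independent and identically distributed. $\to_{\mathbb{P}}$ denotes convergence in probability, $I\{\cdot\}$ the indicator of an event, and $\mathbb{E}$ of a bounded $\mathbf{B}$-valued random variable is its Bochner integral. ''Increasing'' means strictly increasing (as opposed to ''nondecreasing''). *)

(* Defs.v *)
From HB Require Import structures.
From mathcomp Require Import all_boot all_order all_algebra finmap.
From mathcomp Require Import all_classical all_reals all_analysis.

Set Implicit Arguments.
Unset Strict Implicit.
Unset Printing Implicit Defensive.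

Import Order.TTheory GRing.Theory Num.Theory.
Import numFieldNormedType.Exports.

Local Open Scope classical_set_scope.
Local Open Scope ring_scope.

Definition separable_space (T : topologicalType) : Prop :=
  exists D : set T, countable D /\ dense D.

(* Type synonym of [B] carrying the Borel sigma-algebra. *)
Notation borel B := (g_sigma_algebraType (@open B)).

Section BanachRandomVariables.
Context (R : realType) (B : completeNormedModType R)
        (d : measure_display) (T : measurableType d) (P : probability T R).

Definition same_distribution (X Y : T -> borel B) : Prop :=
  forall A : set (borel B), measurable A -> P (X @^-1` A) = P (Y @^-1` A).

Definition symmetric_rv (X : T -> B) : Prop :=
  same_distribution X (fun w => - X w).

Definition mutually_independent (X : nat -> T -> borel B) : Prop :=
  forall (J : {fset nat}) (A : nat -> set (borel B)),
    (forall i, measurable (A i)) ->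
    P (\bigcap_(i in [set` J]) (X i @^-1` A i)) =
    (\big[*%E/1%E]_(i <- J) P (X i @^-1` A i))%E.

(* An i.i.d. sequence {X, X_n; n >= 1} is encoded as a single family indexed by
   [nat], whose member of index 0 is the generic variable X. *)
Definition iid (X : nat -> T -> borel B) : Prop :=
  mutually_independent X /\ forall n, same_distribution (X n) (X 0%N).

Definition cvg_in_probability (Y : nat -> T -> B) (Z : T -> B) : Prop :=
  forall e : R, 0 < e ->
    P [set w | e < `|Y n w - Z w|] @[n --> \oo] --> 0%E.

Definition simple_integral (s : T -> B) : B :=
  \sum_(v \in range s) fine (P (s @^-1` [set v])) *: v.

Definition is_bochner_integral (f : T -> B) (v : B) : Prop :=
  measurable_fun [set: T] (f : T -> borel B) /\
  exists s : nat -> T -> B,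
    [/\ forall k, measurable_fun [set: T] (s k : T -> borel B),
        forall k, finite_set (range (s k)),
        (\int[P]_w (`|f w - s k w|)%:E)%E @[k --> \oo] --> 0%E &
        simple_integral (s k) @[k --> \oo] --> v].

(* Bochner integral with respect to [P], with the junk value 0 when [f] is not
   Bochner integrable. *)
Definition bochner_expectation (f : T -> B) : B :=
  xget 0 [set v | is_bochner_integral f v].

Definition norm_tail (X : T -> B) (t : R) : \bar R := P [set w | t < `|X w|].

Definition partial_sum (X : nat -> T -> B) (n : nat) (w : T) : B :=
  \sum_(1 <= i < n.+1) X i w.

Definition truncated_mean (X : T -> B) (b : nat -> R) (n : nat) : B :=
  n%:R *: bochner_expectation
            (fun w => \1_[set w' | `|X w'| <= b n] w *: X w).

End BanachRandomVariables.

(* Main.v *)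
(* Let [avg phi f y] be the mean of [f (y + phi)]: the [n]-th iterate of this
   operator at 0 is the expectation of [f] at a sum of [n] independent copies
   of [phi], so all inequalities about sums reduce to one-step inequalities
   that [avg] preserves.  Take an independent copy [X'] of [X].

   (a) Rescaling [X - X'] by [a_k / b_k] on [b_(k-1) < max(|X|, |X'|) <= b_k]
   gives a symmetric variable to which the hypothesis applies, so its sums are
   [o(a_n)] in probability.  Truncated at [a_n], they are also [o(a_n)] in L^1,
   by a Hoffmann-Jorgensen inequality.  As [b_n / a_n] is nondecreasing, the
   contraction principle bounds the symmetrized truncated sums by these, and
   Jensen's inequality replaces [X'] by its mean, which is the centering.

   (b) If [P(|S_n - gamma_n| > lambda b_n) -> 0], symmetrization and a Levy
   inequality give [n P(|X| > 3 lambda b_n) -> 0].  Then (a) applies to the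
   sequence [3 lambda b_n], so [S_n / b_n], suitably centered, tends to 0 in
   probability, and the same argument with [lambda = 1/3] gives
   [n P(|X| > b_n) -> 0]. *)
Require Import Defs.
From HB Require Import structures.
From mathcomp Require Import all_boot all_order all_algebra finmap.
From mathcomp Require Import all_classical all_reals all_analysis.
From mathcomp Require Import measurable_realfun ring lra.
Import Order.TTheory GRing.Theory Num.Theory.
Import numFieldNormedType.Exports.
Local Open Scope classical_set_scope.
Local Open Scope ring_scope.

Set Implicit Arguments.
Unset Strict Implicit.
Unset Printing Implicit Defensive.

(** * Borel measurability in a separable space *)

(** The rescaling level is read off the larger of the norms of [X] and [X'], not off the norm of
    [X - X']. A rescaled value beyond [a n] then forces one coordinate beyond [b n], which has
    probability at most [2 P(|X| > b n)]; and when both coordinates are within [b n] the level is at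
    most [n], so the monotone ratio [b / a] bounds the coefficient that undoes the rescaling. The
    difference of the truncated coordinates is not a multiple of the rescaled variable when just one
    coordinate is cut; that event is paid for separately.

    Walks are compared by exchanging one step at a time, as in Lindeberg's method, and first-exit
    arguments become inductions on the number of remaining steps from an arbitrary starting point.

    In (b) the passage from sums to single variables loses a factor 3, so for [lambda > 1/3] it does
    not reach the tail at [b n]. Part (a) turns concentration at one multiple of [b n] into
    concentration at every multiple, with another centering. The tail estimate accepts any
    centering, since centerings cancel in the symmetrized sum, so it can be used again with
    [1/3]. *)

Section BorelMeasurability.
Context {R : realType} {B : completeNormedModType R}.

Lemma open_measurable_borel (U : set (borel B)) : open (U : set B) -> measurable U.
Proof. by move=> oU; exact: sub_sigma_algebra. Qed.

Lemma measurable_fun_borel d (E : measurableType d) (f : E -> borel B) :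
  (forall U : set B, open U -> measurable (f @^-1` U)) ->
  measurable_fun [set: E] f.
Proof.
move=> mf; apply: (measurability (@open B : set (set (borel B)))) => [//|_ [U oU <-]].
by rewrite setTI; exact: mf.
Qed.

Lemma measurable_fun_continuous (f : B -> B) :
  continuous f -> measurable_fun [set: borel B] (f : borel B -> borel B).
Proof.
move=> cf; apply: measurable_fun_borel => U oU.
by apply: open_measurable_borel; apply: open_comp => // x _; exact: cf.
Qed.

Lemma measurable_norm : measurable_fun [set: borel B] (fun x : borel B => `|x : B|).
Proof.
apply: (measurability _ (RGenOInfty.measurableE R)) => _ [_ [x ->] <-].
rewrite setTI; apply: open_measurable_borel.
by apply: open_comp => [y _|]; [exact: norm_continuous|exact: interval_open].
Qed.

Hypothesis separableB : separable_space B.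

(** Separability makes the preimage of an open set a countable union of products of balls, hence
    measurable for the product of the Borel sigma-algebras and not merely for the Borel
    sigma-algebra of the product. *)
Lemma measurable_add :
  measurable_fun [set: borel B * borel B]
    (fun p : borel B * borel B => (p.1 + p.2 : B) : borel B).
Proof.
have [D [cD dD]] := separableB.
apply: measurable_fun_borel => U oU.
pose rad (n : nat) : R := n.+1%:R^-1.
have rad0 n : 0 < rad n by rewrite invr_gt0.
pose K := [set q : B * B * nat | [/\ D q.1.1, D q.1.2 &
  forall x y, ball q.1.1 (rad q.2) x -> ball q.1.2 (rad q.2) y -> U (x + y)]].
rewrite [X in measurable X](_ : _ =
    \bigcup_(q in K) (ball q.1.1 (rad q.2) `*` ball q.1.2 (rad q.2))); last first.
  apply/seteqP; split => [[x y]/= Uxy|[x y] [[[u v] n] [/= Du Dv uvU] [/= ux vy]]];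
    last exact: uvU.
  have [e /= e0 eU] : nbhs_ball (x + y) U.
    by rewrite nbhs_ballE; exact: open_nbhs_nbhs.
  have [n _ ne] := near_infty_natSinv_lt (PosNum (divr_gt0 e0 (ltr0n R 4))).
  (* The difference of the two sums splits into four increments, each shorter than [rad n]. *)
  have {}ne : rad n < e / 4 by exact: ne (leqnn n).
  have [u [xu Du]] := dD (ball x (rad n)) (ex_intro _ x (ballxx _ (rad0 n)))
    (ball_open x (rad n)).
  have [v [yv Dv]] := dD (ball y (rad n)) (ex_intro _ y (ballxx _ (rad0 n)))
    (ball_open y (rad n)).
  exists (u, v, n) => //=; last by split => /=; exact: ball_sym.
  split => //= x' y' ux' vy'; apply: eU.
  move: xu yv ux' vy'; rewrite -!ball_normE /= => xu yv ux' vy'.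
  have -> : x + y - (x' + y') = (x - u) + (u - x') + ((y - v) + (v - y')).
    by rewrite (addrA (x - u)) subrK (addrA (y - v)) subrK opprD addrACA.
  apply: le_lt_trans (ler_normD _ _) _.
  apply: le_lt_trans (lerD (ler_normD _ _) (ler_normD _ _)) _.
  by lra.
have cK : countable K.
  apply: (sub_countable _ (countableX (countableX cD cD) (countableP [set: nat]))).
  by apply: subset_card_le => -[[u v] n] [].
have [->|[g]] := pfcard_geP cK; first by rewrite bigcup_set0.
have <- : range g = K by apply/image_eq.
rewrite bigcup_image; apply: bigcup_measurable => k _.
by apply: measurableX; apply: open_measurable_borel; exact: ball_open.
Qed.

End BorelMeasurability.

Definition mfun_of d d' (E : measurableType d) (F : measurableType d')
    (f : E -> F) (mf : measurable_fun [set: E] f) : {mfun E >-> F} :=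
  HB.pack f (isMeasurableFun.Build _ _ _ _ f mf).

(** * Laws determined by their values on rectangles *)

Section ProductLaws.
Local Open Scope ereal_scope.

(** The factor [c] is absorbed into the first marginal; uniqueness of the product measure then
    applies both to [m'] and to the scaled product. *)
Lemma measure_rectangle_unique d1 d2 (T1 : measurableType d1)
    (T2 : measurableType d2) (R : realType) (m1 : probability T1 R)
    (m2 : probability T2 R) (m' : {measure set (T1 * T2) -> \bar R})
    (c : {nonneg R}) :
  (forall A1 A2, measurable A1 -> measurable A2 ->
    m' (A1 `*` A2) = c%:num%:E * (m1 A1 * m2 A2)) ->
  forall M, measurable M -> m' M = c%:num%:E * (m1 \x m2) M.
Proof.
move=> m'E M mM.
rewrite -(@product_measure_unique _ _ _ _ _ (mscale c m1) m2 m')//.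
  rewrite (@product_measure_unique _ _ _ _ _ (mscale c m1) m2
    (mscale c (m1 \x m2)))// => A1 A2 mA1 mA2.
  transitivity (c%:num%:E * (m1 \x m2) (A1 `*` A2)) => //.
  by rewrite product_measure1E// muleA.
by move=> A1 A2 mA1 mA2; rewrite m'E// /mscale/= muleA.
Qed.

(** The event [E] carries conditions on further variables, with [c] in the role of its probability.
    A factorization known for rectangles thus extends to every measurable [M] while these conditions
    are kept. *)
Lemma joint_law d d1 d2 (T : measurableType d) (T1 : measurableType d1)
    (T2 : measurableType d2) (R : realType) (P : probability T R)
    (W1 : T -> T1) (W2 : T -> T2) (E : set T)
    (m1 : probability T1 R) (m2 : probability T2 R) (c : \bar R) :
  measurable_fun [set: T] W1 -> measurable_fun [set: T] W2 -> measurable E ->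
  c \is a fin_num -> 0 <= c ->
  (forall A1 A2, measurable A1 -> measurable A2 ->
    P (W1 @^-1` A1 `&` W2 @^-1` A2 `&` E) = c * (m1 A1 * m2 A2)) ->
  forall M, measurable M ->
    P ((fun w => (W1 w, W2 w)) @^-1` M `&` E) = c * (m1 \x m2) M.
Proof.
move=> mW1 mW2 mE cfin c0 PE M mM.
have mW : measurable_fun [set: T] (fun w => (W1 w, W2 w)) by exact/measurable_fun_pair.
have c0' : (0 <= fine c)%R by exact: fine_ge0.
rewrite -(fineK cfin).
pose mm : {measure set (T1 * T2) -> \bar R} :=
  pushforward (mrestr P mE) (fun w => (W1 w, W2 w)).
rewrite -(@measure_rectangle_unique _ _ _ _ _ m1 m2 (mm mW) (NngNum c0')) //.
by move=> A1 A2 mA1 mA2 /=; rewrite fineK// -PE.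
Qed.

Lemma ge0_integral_independent d d1 d2 (T : measurableType d)
    (T1 : measurableType d1) (T2 : measurableType d2) (R : realType)
    (P : probability T R) (W1 : T -> T1) (W2 : T -> T2)
    (F : T1 * T2 -> \bar R) :
  measurable_fun [set: T] W1 -> measurable_fun [set: T] W2 ->
  (forall A1 A2, measurable A1 -> measurable A2 ->
    P (W1 @^-1` A1 `&` W2 @^-1` A2) = P (W1 @^-1` A1) * P (W2 @^-1` A2)) ->
  measurable_fun [set: T1 * T2] F -> (forall p, 0 <= F p) ->
  \int[P]_w F (W1 w, W2 w) = \int[P]_w \int[P]_v F (W1 w, W2 v).
Proof.
move=> mW1 mW2 indep mF F0.
have mW : measurable_fun [set: T] (fun w => (W1 w, W2 w)) by exact/measurable_fun_pair.
pose m1 : probability T1 R := distribution P (mfun_of mW1).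
pose m2 : probability T2 R := distribution P (mfun_of mW2).
have -> : \int[P]_w F (W1 w, W2 w) = \int[distribution P (mfun_of mW)]_p F p.
  by rewrite ge0_integral_distribution.
rewrite (@eq_measure_integral _ _ _ _ (m1 \x m2)); last first.
  move=> M mM _.
  rewrite -[RHS]mul1e -(@joint_law _ _ _ _ _ _ _ P W1 W2 setT)//.
    by rewrite setIT.
  by move=> A1 A2 mA1 mA2; rewrite setIT mul1e indep.
rewrite fubini_tonelli1//.
rewrite ge0_integral_distribution//.
- by apply: eq_integral => w _ /=; rewrite /fubini_F ge0_integral_distribution//;
    apply: measurableT_comp.
- exact: measurable_fun_fubini_tonelli_F.
- by move=> y; exact: integral_ge0.
Qed.

End ProductLaws.

(** * Sums of independent variables *)

Section RandomWalk.
Local Open Scope ereal_scope.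
Context {R : realType} {B : completeNormedModType R}.
Hypothesis separableB : separable_space B.
Context d (T : measurableType d) (Q : probability T R) (Y : nat -> T -> borel B).
Hypothesis mY : forall n, measurable_fun [set: T] (Y n).

Lemma partial_sum0 w : partial_sum Y 0 w = 0%R.
Proof. by rewrite /partial_sum big_geq. Qed.

Lemma partial_sumS n w : partial_sum Y n.+1 w = (partial_sum Y n w + Y n.+1 w)%R.
Proof. by rewrite /partial_sum big_nat_recr. Qed.

Lemma measurable_partial_sum n :
  measurable_fun [set: T] (partial_sum Y n : T -> borel B).
Proof.
elim: n => [|n IHn].
  by rewrite (_ : partial_sum Y 0 = cst 0%R)//; apply/funext => w; rewrite partial_sum0.
rewrite (_ : partial_sum Y n.+1 = (fun p : borel B * borel B => (p.1 + p.2)%R : borel B)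
    \o (fun w => (partial_sum Y n w : borel B, Y n.+1 w))).
  by apply: measurableT_comp; [exact: measurable_add|exact/measurable_fun_pair].
by apply/funext => w; rewrite partial_sumS.
Qed.

Lemma measurable_bigcap_preimage (J : {fset nat}) (A : nat -> set (borel B)) :
  (forall i, measurable (A i)) ->
  measurable (\bigcap_(i in [set` J]) (Y i @^-1` A i)).
Proof.
move=> mA; apply: fin_bigcap_measurable => // i _.
by rewrite -[X in measurable X]setTI; exact: mY.
Qed.

Hypothesis indepY : mutually_independent Q Y.

(** The induction needs an arbitrary finite set [J] of later indices: the condition on the newest
    summand is moved into [J], where the hypothesis for the shorter sum can treat it. *)
Lemma partial_sum_independent n C (J : {fset nat}) (A : nat -> set (borel B)) :
  measurable C -> (forall i, measurable (A i)) ->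
  (forall i, i \in J -> (n < i)%N) ->
  Q ((partial_sum Y n : T -> borel B) @^-1` C `&`
       \bigcap_(i in [set` J]) (Y i @^-1` A i)) =
  Q ((partial_sum Y n : T -> borel B) @^-1` C) *
  Q (\bigcap_(i in [set` J]) (Y i @^-1` A i)).
Proof.
elim: n C J A => [|n IHn] C J A mC mA nJ.
  rewrite (_ : partial_sum Y 0 = cst 0%R); last by apply/funext => w; rewrite partial_sum0.
  rewrite preimage_cst; case: ifPn => _.
    by rewrite setTI probability_setT mul1e.
  by rewrite set0I measure0 mul0e.
pose S : {mfun T >-> borel B} := mfun_of (measurable_partial_sum n).
pose M := [set p : borel B * borel B | C (p.1 + p.2)%R].
have mM : measurable M.
  by have := measurable_add separableB measurableT mC; rewrite setTI.
(* Used twice: for [J], and for the empty set, where it identifies the product measure of [M] as the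
   probability that the longer sum lies in [C]. *)
have joint (J' : {fset nat}) : (forall i, i \in J' -> (n.+1 < i)%N) ->
    Q ((partial_sum Y n.+1 : T -> borel B) @^-1` C `&`
       \bigcap_(i in [set` J']) (Y i @^-1` A i)) =
    Q (\bigcap_(i in [set` J']) (Y i @^-1` A i)) *
    (distribution Q S \x distribution Q (mfun_of (mY n.+1))) M.
  move=> nJ'; rewrite (_ : _ @^-1` C = (fun w => (S w, Y n.+1 w)) @^-1` M); last first.
    by apply/seteqP; split => w /=; rewrite partial_sumS.
  apply: joint_law => //; first exact: measurable_bigcap_preimage.
    exact: fin_num_measure (measurable_bigcap_preimage _ mA).
  move=> A1 A2 mA1 mA2.
  pose A' i := if i == n.+1 then A2 else A i.
  have mA' i : measurable (A' i) by rewrite /A'; case: ifP.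
  have nJ1 : n.+1 \notin J' by apply/negP => /nJ'; rewrite ltnn.
  have A'E i : i \in J' -> A' i = A i.
    by move=> iJ; rewrite /A' ifN//; apply: contraNneq nJ1 => <-.
  have -> : S @^-1` A1 `&` Y n.+1 @^-1` A2 `&`
      \bigcap_(i in [set` J']) (Y i @^-1` A i) =
      S @^-1` A1 `&` \bigcap_(i in [set` (n.+1 |` J')%fset]) (Y i @^-1` A' i).
    rewrite -setIA; congr (_ `&` _); apply/seteqP; split => w.
      move=> [/= Yw Jw] i /=; rewrite in_fset1U => /orP[/eqP->|iJ].
        by rewrite /A' eqxx.
      by rewrite A'E//; exact: Jw.
    move=> Jw; split.
      by have /= := Jw n.+1; rewrite fset1U1 /A' eqxx; exact.
    by move=> i /= iJ; rewrite -A'E//; apply: Jw; rewrite /= in_fset1U iJ orbT.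
  rewrite IHn//; last first.
    move=> i; rewrite in_fset1U => /orP[/eqP->//|/nJ']; exact: ltnW.
  have -> : Q (\bigcap_(i in [set` J']) (Y i @^-1` A i)) =
      \big[*%E/1]_(i <- J') Q (Y i @^-1` A' i).
    by rewrite indepY// !big_seq; apply: eq_bigr => i iJ; rewrite A'E.
  by rewrite indepY// big_fsetU1//= {1}/A' eqxx muleA muleC.
rewrite joint//.
have := joint fset0; rewrite set_fset0 bigcap_set0 setIT probability_setT mul1e => -> //.
by rewrite muleC.
Qed.

End RandomWalk.

(** * The averaging operator *)

Section Averages.
Local Open Scope ereal_scope.
Context {R : realType} {B : completeNormedModType R}.

Definition nonneg_borel (f : B -> \bar R) : Prop :=
  measurable_fun [set: borel B] (f : borel B -> \bar R) /\ forall x, 0 <= f x.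

Context d (E : measurableType d) (nu : probability E R).

Definition avg (phi : E -> B) (f : B -> \bar R) (y : B) : \bar R :=
  \int[nu]_e f (y + phi e)%R.

Hypothesis separableB : separable_space B.
Implicit Types (phi psi : E -> borel B) (f g : B -> \bar R).

Lemma measurable_shift d' (F : measurableType d') (u v : F -> borel B) f :
  measurable_fun [set: F] u -> measurable_fun [set: F] v -> nonneg_borel f ->
  measurable_fun [set: F] (fun e => f (u e + v e)%R).
Proof.
move=> mu mv [mf _].
have := measurableT_comp mf (measurableT_comp (measurable_add separableB)
  (measurable_fun_pair mu mv)).
exact.
Qed.

Lemma measurable_translate phi f y : measurable_fun [set: E] phi ->
  nonneg_borel f -> measurable_fun [set: E] (fun e => f (y + phi e)%R).
Proof.
by move=> mphi; apply: (@measurable_shift _ _ (cst y)) => //; exact: measurable_cst.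
Qed.

Lemma nonneg_borel_avg phi f : measurable_fun [set: E] phi ->
  nonneg_borel f -> nonneg_borel (avg phi f).
Proof.
move=> mphi bf; split; last by move=> y; apply: integral_ge0 => e _; exact: bf.2.
apply: (@measurable_fun_fubini_tonelli_F _ _ _ _ _ nu
  (fun p : borel B * E => f (p.1 + phi p.2)%R)) => [|p]; last exact: bf.2.
apply: (@measurable_shift _ _ fst (phi \o snd)) => //; exact: measurableT_comp.
Qed.

Lemma nonneg_borel_iter_avg phi f n : measurable_fun [set: E] phi ->
  nonneg_borel f -> nonneg_borel (iter n (avg phi) f).
Proof. by move=> mphi bf; elim: n => //= n IHn; exact: nonneg_borel_avg. Qed.

Lemma le_avg phi f g : measurable_fun [set: E] phi ->
  nonneg_borel f -> nonneg_borel g -> (forall x, f x <= g x) ->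
  forall y, avg phi f y <= avg phi g y.
Proof.
move=> mphi bf bg fg y; apply: ge0_le_integral => //.
- by move=> e _; exact: bf.2.
- exact: measurable_translate.
- exact: measurable_translate.
Qed.

Lemma le_iter_avg phi f g n : measurable_fun [set: E] phi ->
  nonneg_borel f -> nonneg_borel g -> (forall x, f x <= g x) ->
  forall y, iter n (avg phi) f y <= iter n (avg phi) g y.
Proof.
move=> mphi bf bg fg; elim: n => //= n IHn.
by apply: le_avg => //; exact: nonneg_borel_iter_avg.
Qed.

End Averages.

Section RandomWalkAverage.
Local Open Scope ereal_scope.
Context {R : realType} {B : completeNormedModType R}.
Hypothesis separableB : separable_space B.
Context d (T : measurableType d) (Q : probability T R) (Y : nat -> T -> borel B).
Hypothesis mY : forall n, measurable_fun [set: T] (Y n).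
Hypothesis iidY : iid Q Y.

Lemma integral_partial_sum f n : nonneg_borel f ->
  \int[Q]_w f (partial_sum Y n w) = iter n (avg Q (Y 0)) f 0%R.
Proof.
elim: n f => [|n IHn] f bf.
  under eq_integral do rewrite partial_sum0.
  by rewrite integral_cst//= probability_setT mule1.
(* The last summand is integrated out first, so its average is the innermost one. *)
rewrite iterSr -IHn; last exact: nonneg_borel_avg.
under eq_integral do rewrite partial_sumS.
have mS := measurable_partial_sum separableB mY n.
rewrite (@ge0_integral_independent _ _ _ _ _ _ _ Q
  (partial_sum Y n : T -> borel B) (Y n.+1)
  (fun p : borel B * borel B => f (p.1 + p.2)%R))//.
- apply: eq_integral => w _.
  transitivity (\int[distribution Q (mfun_of (mY n.+1))]_x f (partial_sum Y n w + x)%R).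
    rewrite ge0_integral_distribution//; last by move=> x; exact: bf.2.
    by apply: measurable_shift => //; exact: measurable_cst.
  rewrite (@eq_measure_integral _ _ _ _ (distribution Q (mfun_of (mY 0%N)))); last first.
    by move=> A mA _; exact: iidY.2.
  rewrite ge0_integral_distribution//; last by move=> x; exact: bf.2.
  by apply: measurable_shift => //; exact: measurable_cst.
- move=> A1 A2 mA1 mA2.
  have := @partial_sum_independent _ _ separableB _ _ _ _ mY iidY.1 n A1 [fset n.+1]%fset
    (fun=> A2) mA1 (fun=> mA2).
  rewrite set_fset1 bigcap_set1; apply.
  by move=> i; rewrite in_fset1 => /eqP->.
- exact: (@measurable_shift _ _ _ _ _ fst snd).
- by move=> p; exact: bf.2.
Qed.

End RandomWalkAverage.

(** * Inequalities for iterated averages *)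

Section AverageInequalities.
Local Open Scope ereal_scope.
Context {R : realType} {B : completeNormedModType R}.
Hypothesis separableB : separable_space B.
Context d (E : measurableType d) (nu : probability E R).
Implicit Types (phi psi : E -> borel B) (f g : B -> \bar R).

Definition norm_ereal (x : B) : \bar R := `|x|%:E.

Definition exceeds (t : R) (x : B) : \bar R := (\1_[set z : B | (t < `|z|)%R] x)%:E.

Lemma measurable_exceeds_set (t : R) : measurable [set z : borel B | (t < `|(z : B)|)%R].
Proof.
rewrite (_ : mkset _ = (fun x : borel B => `|(x : B)|%R) @^-1` `]t, +oo[%classic); last first.
  by apply/seteqP; split => x /=; rewrite in_itv/= andbT.
by rewrite -[X in measurable X]setTI; exact: measurable_norm.
Qed.

Lemma nonneg_borel_norm : nonneg_borel norm_ereal.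
Proof.
split => [|x]; last by rewrite lee_fin.
exact: (measurableT_comp (@EFin_measurable R setT) measurable_norm).
Qed.

Lemma nonneg_borel_exceeds t : nonneg_borel (exceeds t).
Proof.
split => [|x]; last by rewrite lee_fin.
exact: (measurableT_comp (@EFin_measurable R setT)
  (@measurable_indic _ _ _ setT _ (measurable_exceeds_set t))).
Qed.

Lemma exceedsE t x : exceeds t x = (t < `|x|)%R%:R%:E.
Proof.
by rewrite /exceeds indicE (_ : (x \in _) = (t < `|x|)%R)//; apply/idP/idP; rewrite inE.
Qed.

Lemma nonneg_borelD_cst f (c : R) : (0 <= c)%R ->
  nonneg_borel f -> nonneg_borel (fun x => f x + c%:E).
Proof.
move=> c0 [mf f0]; split => [|x]; last by rewrite adde_ge0.
by apply: emeasurable_funD => //; exact: measurable_cst.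
Qed.

Lemma nonneg_borelZ f (c : R) : (0 <= c)%R ->
  nonneg_borel f -> nonneg_borel (fun x => c%:E * f x).
Proof.
move=> c0 [mf f0]; split => [|x]; last by rewrite mule_ge0.
exact: measurable_funeM.
Qed.

Lemma integralD_cst (h : E -> \bar R) (c : R) : (0 <= c)%R ->
  measurable_fun [set: E] h -> (forall e, 0 <= h e) ->
  \int[nu]_e (h e + c%:E) = \int[nu]_e h e + c%:E.
Proof.
move=> c0 mh h0; rewrite ge0_integralD//.
by rewrite integral_cst//= probability_setT mule1.
Qed.

Lemma avgD_cst phi f (c : R) y : measurable_fun [set: E] phi -> (0 <= c)%R ->
  nonneg_borel f -> avg nu phi (fun x => f x + c%:E) y = avg nu phi f y + c%:E.
Proof.
move=> mphi c0 bf; rewrite /avg integralD_cst//; last by move=> e; exact: bf.2.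
exact: measurable_translate.
Qed.

Lemma avgZ phi f (c : R) y : measurable_fun [set: E] phi -> (0 <= c)%R ->
  nonneg_borel f -> avg nu phi (fun x => c%:E * f x) y = c%:E * avg nu phi f y.
Proof.
move=> mphi c0 bf; rewrite /avg ge0_integralZl//.
- exact: measurable_translate.
- by move=> e _; exact: bf.2.
Qed.

Lemma iter_avgZ phi f (c : R) n y : measurable_fun [set: E] phi -> (0 <= c)%R ->
  nonneg_borel f ->
  iter n (avg nu phi) (fun x => c%:E * f x) y = c%:E * iter n (avg nu phi) f y.
Proof.
move=> mphi c0 bf; elim: n y => //= n IHn y.
rewrite -avgZ//; last exact: nonneg_borel_iter_avg.
by congr (avg _ _ _ _); apply/funext.
Qed.

Lemma avgD phi psi f y z : measurable_fun [set: E] phi ->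
  measurable_fun [set: E] psi -> nonneg_borel f ->
  avg nu phi f y + avg nu psi f z =
  \int[nu]_e (f (y + phi e)%R + f (z + psi e)%R).
Proof.
move=> mphi mpsi bf; rewrite /avg ge0_integralD//.
- by move=> e _; exact: bf.2.
- exact: measurable_translate.
- by move=> e _; exact: bf.2.
- exact: measurable_translate.
Qed.

Lemma measurable_translateD phi psi f y z : measurable_fun [set: E] phi ->
  measurable_fun [set: E] psi -> nonneg_borel f ->
  measurable_fun [set: E] (fun e => f (y + phi e)%R + f (z + psi e)%R).
Proof. by move=> mphi mpsi bf; apply: emeasurable_funD; exact: measurable_translate. Qed.

Lemma measurable_opp phi : measurable_fun [set: E] phi ->
  measurable_fun [set: E] (fun e => (- phi e)%R : borel B).
Proof.
move=> mphi; apply: (measurableT_comp (measurable_fun_continuous _) mphi).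
exact: opp_continuous.
Qed.

Definition lipschitz1 f := forall x y, f x <= f y + `|x - y|%:E.

Lemma lipschitz1_norm : lipschitz1 norm_ereal.
Proof.
by move=> x y; rewrite /norm_ereal -EFinD lee_fin -{1}(subrKC y x) ler_normD.
Qed.

Lemma lipschitz1_avg phi f : measurable_fun [set: E] phi -> nonneg_borel f ->
  lipschitz1 f -> lipschitz1 (avg nu phi f).
Proof.
move=> mphi bf lf x y; rewrite -avgD_cst//.
apply: ge0_le_integral => //.
- by move=> e _; exact: bf.2.
- exact: measurable_translate.
- apply: (@measurable_translate _ _ _ _ separableB phi (fun z => f z + `|x - y|%:E)) => //.
  exact: nonneg_borelD_cst.
- by move=> e _; rewrite (le_trans (lf _ (y + phi e)%R))// opprD addrACA subrr addr0.
Qed.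

Lemma lipschitz1_iter_avg phi f n : measurable_fun [set: E] phi -> nonneg_borel f ->
  lipschitz1 f -> lipschitz1 (iter n (avg nu phi) f).
Proof.
move=> mphi bf lf; elim: n => //= n IHn.
by apply: lipschitz1_avg => //; exact: nonneg_borel_iter_avg.
Qed.

(** Lindeberg exchange: [delta] bounds the cost of one exchange uniformly in the position and in the
    number of remaining [phi] steps, so [n] exchanges cost [n] times its mean. *)
Lemma iter_avg_replace phi psi f (delta : E -> \bar R) n y :
  measurable_fun [set: E] phi -> measurable_fun [set: E] psi ->
  measurable_fun [set: E] delta -> (forall e, 0 <= delta e) ->
  \int[nu]_e delta e \is a fin_num ->
  nonneg_borel f ->
  (forall k y e, iter k (avg nu phi) f (y + phi e)%R <=
                 iter k (avg nu phi) f (y + psi e)%R + delta e) ->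
  iter n (avg nu phi) f y <=
  iter n (avg nu psi) f y + n%:R%:E * \int[nu]_e delta e.
Proof.
move=> mphi mpsi mdelta delta0 fdelta bf H.
have int0 : 0 <= \int[nu]_e delta e by exact: integral_ge0.
have bphi k := @nonneg_borel_iter_avg _ _ _ _ nu separableB phi f k mphi bf.
have bpsi k := @nonneg_borel_iter_avg _ _ _ _ nu separableB psi f k mpsi bf.
elim: n y => [|n IHn] y /=; first by rewrite mul0e adde0.
apply: (@le_trans _ _ (avg nu psi (iter n (avg nu phi) f) y + \int[nu]_e delta e)).
  rewrite -ge0_integralD//.
  - apply: ge0_le_integral => //.
    + by move=> e _; exact: (bphi n).2.
    + exact: measurable_translate.
    + by apply: emeasurable_funD => //; exact: measurable_translate.
  - by move=> e _; exact: (bphi n).2.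
  - exact: measurable_translate.
move: (\int[nu]_e delta e) int0 fdelta IHn => I I0 Ifin IHn.
rewrite -natr1 EFinD ge0_muleDl// mul1e addeA; apply: leeD2r.
have nI0 : (0 <= n%:R * fine I)%R by rewrite mulr_ge0// fine_ge0.
rewrite -(fineK Ifin) -EFinM -avgD_cst//.
apply: le_avg => //; first exact: nonneg_borelD_cst.
by move=> x; rewrite EFinM fineK.
Qed.

Lemma iter_avg_le1 phi f n : measurable_fun [set: E] phi -> nonneg_borel f ->
  (forall x, f x <= 1) -> forall y, iter n (avg nu phi) f y <= 1.
Proof.
move=> mphi bf f1; elim: n => //= n IHn y.
have bn := @nonneg_borel_iter_avg _ _ _ _ nu separableB phi f n mphi bf.
rewrite -[leRHS](mule1 1) -(probability_setT nu) -integral_cst//.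
apply: ge0_le_integral => //.
- by move=> e _; exact: bn.2.
- exact: measurable_translate.
by move=> e _ /=; rewrite probability_setT.
Qed.

(** Averages of [f] stay in [[0, 1]], so an exchange costs at most 1 on [W] and nothing elsewhere:
    [delta] is the indicator of [W]. *)
Lemma iter_avg_replace_event phi psi f (W : set E) n y :
  measurable_fun [set: E] phi -> measurable_fun [set: E] psi -> measurable W ->
  nonneg_borel f -> (forall x, f x <= 1) ->
  (forall e, ~ W e -> phi e = psi e) ->
  iter n (avg nu phi) f y <= iter n (avg nu psi) f y + n%:R%:E * nu W.
Proof.
move=> mphi mpsi mW bf f1 eqW.
rewrite -[W in nu W]setIT -(integral_indic _ measurableT)//.
apply: iter_avg_replace => //.
  by apply/measurable_EFinP; exact: measurable_indic.
  by rewrite integral_indic// setIT fin_num_measure.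
move=> k x e; rewrite indicE; case: (boolP (e \in W)) => [_|/negP].
  rewrite (le_trans (iter_avg_le1 _ mphi bf f1 _))// leeDr//.
  exact: (@nonneg_borel_iter_avg _ _ _ _ nu separableB phi f k mphi bf).2.
by rewrite inE => /eqW ->; rewrite adde0.
Qed.

Lemma iter_avg_replace_lipschitz phi psi f n y :
  measurable_fun [set: E] phi -> measurable_fun [set: E] psi ->
  nonneg_borel f -> lipschitz1 f ->
  \int[nu]_e `|phi e - psi e|%:E \is a fin_num ->
  iter n (avg nu phi) f y <=
  iter n (avg nu psi) f y + n%:R%:E * \int[nu]_e `|phi e - psi e|%:E.
Proof.
move=> mphi mpsi bf lf fint; apply: iter_avg_replace => //.
  apply: (@measurable_shift _ _ separableB _ _ phi (fun e => - psi e)%R norm_ereal) => //.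
    exact: measurable_opp.
  exact: nonneg_borel_norm.
move=> k x e; have -> : (phi e - psi e = (x + phi e) - (x + psi e))%R.
  by rewrite opprD addrACA subrr add0r.
exact: lipschitz1_iter_avg.
Qed.

End AverageInequalities.

(** * Symmetric steps: contraction, reflection and maximal-type inequalities *)

Section SymmetricAverages.
Local Open Scope ereal_scope.
Context {R : realType} {B : completeNormedModType R}.
Hypothesis separableB : separable_space B.
Context d (E : measurableType d) (nu : probability E R).
Implicit Types (phi psi : E -> borel B) (f g : B -> \bar R).

(** Symmetry of the law of [phi], phrased through [avg] so that a step can be reflected inside any
    iterate. *)
Definition sign_invariant phi := forall f y, nonneg_borel f ->
  avg nu phi f y = avg nu (fun e => (- phi e)%R) f y.

(** Symmetry is exploited by adding the two reflected integrands; comparing doubled quantities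
    avoids halving in [\bar R], where infinite values may occur. *)
Lemma lee_double (x y : \bar R) : x + x <= y + y -> x <= y.
Proof.
case: x y => [x||] [y||] //=; rewrite ?leey ?leNye//.
by rewrite -!EFinD !lee_fin -!mulr2n ler_pMn2r.
Qed.

Lemma avg_double phi f y : measurable_fun [set: E] phi -> nonneg_borel f ->
  sign_invariant phi ->
  avg nu phi f y + avg nu phi f y =
  \int[nu]_e (f (y + phi e)%R + f (y - phi e)%R).
Proof.
move=> mphi bf sphi; rewrite {2}sphi// avgD//.
exact: measurable_opp.
Qed.

(** The consequence of convexity behind the contraction principle. It is inherited by averages,
    which makes the step-by-step comparison possible. *)
Definition spread_increasing f := forall y v (theta : R), (0 <= theta <= 1)%R ->
  f (y + theta *: v)%R + f (y - theta *: v)%R <= f (y + v)%R + f (y - v)%R.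

Lemma spread_increasing_norm : spread_increasing (@norm_ereal R B).
Proof.
move=> y v th /andP[th0 th1]; rewrite /norm_ereal -!EFinD lee_fin.
(* Both [y + th *: v] and [y - th *: v] are convex combinations of [y + v] and [y - v], with the
   weights [l] and [l'] exchanged. *)
pose l := ((1 + th) / 2)%R; pose l' := ((1 - th) / 2)%R.
have l0 : (0 <= l)%R by rewrite /l; lra.
have l0' : (0 <= l')%R by rewrite /l'; lra.
have ll : (l + l' = 1)%R by rewrite /l /l'; lra.
have lB : (l - l' = th)%R by rewrite /l /l'; lra.
move: l l' l0 l0' ll lB => l l' l0 l0' ll lB.
have -> : (y + th *: v = l *: (y + v) + l' *: (y - v))%R.
  by rewrite !scalerDr addrACA -scalerDl scalerN -scalerBl ll lB scale1r.
have -> : (y - th *: v = l' *: (y + v) + l *: (y - v))%R.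
  by rewrite !scalerDr addrACA -scalerDl scalerN -scalerBl -scaleNr -lB opprB
    (addrC l' l) ll scale1r.
apply: (le_trans (lerD (ler_normD _ _) (ler_normD _ _))).
rewrite !normrZ (ger0_norm l0) (ger0_norm l0') addrACA -!mulrDl.
by rewrite (addrC l' l) ll !mul1r.
Qed.

Lemma spread_increasing_avg phi f : measurable_fun [set: E] phi ->
  nonneg_borel f -> spread_increasing f -> spread_increasing (avg nu phi f).
Proof.
move=> mphi bf sf y v th th01; rewrite !avgD//; apply: ge0_le_integral => //.
- by move=> e _; rewrite adde_ge0//; exact: bf.2.
- exact: measurable_translateD.
- exact: measurable_translateD.
- by move=> e _; rewrite ![(y + _ + phi e)%R]addrAC; exact: sf.
Qed.

Lemma spread_increasing_iter_avg phi f n : measurable_fun [set: E] phi ->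
  nonneg_borel f -> spread_increasing f ->
  spread_increasing (iter n (avg nu phi) f).
Proof.
move=> mphi bf sf; elim: n => //= n IHn.
by apply: spread_increasing_avg => //; exact: nonneg_borel_iter_avg.
Qed.

(** The coefficient may be random: since [phi] and [psi] are both sign invariant, each average can
    be doubled and the integrands compared at every [e], where [theta e] is a fixed number. *)
Lemma avg_contraction phi psi (theta : E -> R) f y :
  measurable_fun [set: E] phi -> measurable_fun [set: E] psi ->
  sign_invariant phi -> sign_invariant psi ->
  (forall e, (0 <= theta e <= 1)%R) -> (forall e, psi e = (theta e *: (phi e : B))%R) ->
  nonneg_borel f -> spread_increasing f -> avg nu psi f y <= avg nu phi f y.
Proof.
move=> mphi mpsi sphi spsi th01 psiE bf sf; apply: lee_double.
rewrite !avg_double//; apply: ge0_le_integral => //.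
- by move=> e _; rewrite adde_ge0//; exact: bf.2.
- by apply: measurable_translateD => //; exact: measurable_opp.
- by apply: measurable_translateD => //; exact: measurable_opp.
- by move=> e _; rewrite psiE; exact: sf.
Qed.

Lemma iter_avg_contraction phi psi (theta : E -> R) f n y :
  measurable_fun [set: E] phi -> measurable_fun [set: E] psi ->
  sign_invariant phi -> sign_invariant psi ->
  (forall e, (0 <= theta e <= 1)%R) -> (forall e, psi e = (theta e *: (phi e : B))%R) ->
  nonneg_borel f -> spread_increasing f ->
  iter n (avg nu psi) f y <= iter n (avg nu phi) f y.
Proof.
move=> mphi mpsi sphi spsi th01 psiE bf sf; elim: n y => //= n IHn y.
apply: (@le_trans _ _ (avg nu psi (iter n (avg nu phi) f) y)).
  by apply: le_avg => //; exact: nonneg_borel_iter_avg.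
apply: avg_contraction => //; first exact: nonneg_borel_iter_avg.
exact: spread_increasing_iter_avg.
Qed.

Lemma integral_ge_cst (h : E -> \bar R) (c : R) : measurable_fun [set: E] h ->
  (0 <= c)%R -> (forall e, c%:E <= h e) -> c%:E <= \int[nu]_e h e.
Proof.
move=> mh c0 ch; rewrite -[leLHS](mule1 c%:E) -(probability_setT nu) -integral_cst//.
by apply: ge0_le_integral => // e _ /=; rewrite lee_fin.
Qed.

(** The point [y] is the midpoint of [y + x] and [y - x], so these cannot both lie in the ball of
    radius [t]. *)
Lemma exceeds_reflect (t : R) (x y : B) : (t < `|y|)%R ->
  1 <= exceeds t (y + x)%R + exceeds t (y - x)%R.
Proof.
move=> ty; rewrite !exceedsE -EFinD lee_fin -natrD ler1n.
case: ltP => //= h1; case: ltP => //= h2.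
have : (`|y + y| <= `|y + x| + `|y - x|)%R.
  by rewrite -{1}(addr0 (y + y)%R) -(subrr x) addrACA; exact: ler_normD.
by rewrite -mulr2n normrMn; move: ty h1 h2; lra.
Qed.

(** Reflection principle: the walk from [y - s] takes the opposite steps of the walk from [y + s],
    so [y] remains their midpoint. The offset [s] is there for the induction; [s = 0] gives
    probability at least 1/2. *)
Lemma iter_avg_exceeds_reflect phi (t : R) k y s : measurable_fun [set: E] phi ->
  sign_invariant phi -> (t < `|y|)%R ->
  1 <= iter k (avg nu phi) (exceeds t) (y + s)%R +
       iter k (avg nu phi) (exceeds t) (y - s)%R.
Proof.
move=> mphi sphi ty; elim: k s => [|k IHk] s /=; first exact: exceeds_reflect.
have bk := @nonneg_borel_iter_avg _ _ _ _ nu separableB phi _ k mphi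
  (nonneg_borel_exceeds t).
rewrite [X in _ + X]sphi// avgD//; last exact: measurable_opp.
apply: integral_ge_cst => //.
  by apply: measurable_translateD => //; exact: measurable_opp.
by move=> e; rewrite -!addrA -opprD; exact: IHk.
Qed.

(** The extra step is taken innermost, where the claim reduces to the midpoint inequality for the
    norm. *)
Lemma iter_avg_norm_nondecr phi k : measurable_fun [set: E] phi ->
  sign_invariant phi -> forall y,
  iter k (avg nu phi) (@norm_ereal R B) y <= iter k.+1 (avg nu phi) (@norm_ereal R B) y.
Proof.
move=> mphi sphi; have bN := @nonneg_borel_norm R B.
rewrite iterSr; apply: le_iter_avg => //; first exact: nonneg_borel_avg.
move=> y; apply: lee_double; rewrite avg_double//.
rewrite /norm_ereal -EFinD; apply: integral_ge_cst.
- by apply: (@measurable_translateD _ _ separableB _ _ phi (fun e => - phi e)%R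
    (@norm_ereal R B)) => //; exact: measurable_opp.
- by rewrite addr_ge0.
move=> e; rewrite -EFinD lee_fin -mulr2n -normrMn mulr2n.
by rewrite -{1}(addr0 (y + y)%R) -(subrr (phi e : B)) addrACA; exact: ler_normD.
Qed.

(** A crude bound; its purpose is to make the mean norm finite, so that a fraction of it can later
    be absorbed. *)
Lemma iter_avg_norm_le phi (a : R) n : measurable_fun [set: E] phi ->
  (0 <= a)%R -> (forall e, (`|phi e : B| <= a)%R) ->
  iter n (avg nu phi) (@norm_ereal R B) 0%R <= (n%:R * a)%:E.
Proof.
move=> mphi a0 phia; have bN := @nonneg_borel_norm R B.
have Lk k := lipschitz1_iter_avg separableB nu k mphi bN (@lipschitz1_norm R B).
have bk k := @nonneg_borel_iter_avg _ _ _ _ nu separableB phi _ k mphi bN.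
elim: n => [|n IHn] /=; first by rewrite /norm_ereal normr0 mul0r.
rewrite -natr1 mulrDl mul1r.
have na0 : (0 <= n%:R * a + a)%R by rewrite addr_ge0// mulr_ge0.
rewrite -[leRHS]mule1 -(probability_setT nu) -integral_cst//.
apply: ge0_le_integral => //.
- by move=> e _; exact: (bk n).2.
- exact: measurable_translate.
move=> e _ /=; rewrite EFinD (le_trans (Lk n _ 0%R))// leeD//.
by rewrite add0r subr0 lee_fin.
Qed.

(* A Hoffmann-Jorgensen type inequality: once the walk leaves the ball of
   radius [t], its position is at most [t + a] and, by symmetry, it is outside
   this ball at time [n] with conditional probability at least 1/2. *)
Lemma iter_avg_norm_le_exceeds phi (a t m : R) n : measurable_fun [set: E] phi ->
  sign_invariant phi -> (0 <= a)%R -> (0 <= t)%R ->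
  (forall e, (`|phi e : B| <= a)%R) ->
  iter n (avg nu phi) (@norm_ereal R B) 0%R = m%:E ->
  m%:E <= t%:E + (2 * (a + m))%:E * iter n (avg nu phi) (exceeds t) 0%R.
Proof.
move=> mphi sphi a0 t0 phia mE; have bN := @nonneg_borel_norm R B.
have bG := @nonneg_borel_exceeds R B t.
have Lk k := lipschitz1_iter_avg separableB nu k mphi bN (@lipschitz1_norm R B).
have bk k := @nonneg_borel_iter_avg _ _ _ _ nu separableB phi _ k mphi bN.
have bgk k := @nonneg_borel_iter_avg _ _ _ _ nu separableB phi _ k mphi bG.
have m0 : (0 <= m)%R by rewrite -lee_fin -mE; exact: (bk n).2.
have mk k : (k <= n)%N -> iter k (avg nu phi) (@norm_ereal R B) 0%R <= m%:E.
  rewrite -mE; have nd : {homo (fun k => iter k (avg nu phi) (@norm_ereal R B) 0%R) :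
      x y / (x <= y)%N >-> x <= y}.
    by apply: homo_leq => [//|y x z|k']; [exact: le_trans|exact: iter_avg_norm_nondecr].
  exact: nd.
have c0 : (0 <= 2 * (a + m))%R by rewrite mulr_ge0// addr_ge0.
(* Here [k] counts the remaining steps and [y] is a current position that has not left the ball. *)
rewrite -[leLHS]mE; suff H k : (k <= n)%N -> forall y : B, (`|y| <= t)%R ->
    iter k (avg nu phi) (@norm_ereal R B) y <=
    t%:E + (2 * (a + m))%:E * iter k (avg nu phi) (exceeds t) y.
  by apply: H => //; rewrite normr0.
elim: k => [_ y yt|k IHk kn y yt] /=.
  rewrite -[leLHS]adde0; apply: leeD; first by rewrite lee_fin.
  by rewrite mule_ge0//; exact: bG.2.
rewrite addeC -avgZ// -avgD_cst//; last exact: nonneg_borelZ.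
apply: ge0_le_integral => //.
- by move=> e _; exact: (bk k).2.
- exact: measurable_translate.
- apply: (@measurable_translate _ _ _ _ separableB phi (fun z =>
    (2 * (a + m))%:E * iter k (avg nu phi) (exceeds t) z + t%:E)) => //.
  by apply: nonneg_borelD_cst => //; exact: nonneg_borelZ.
move=> e _; have [yt'|yt'] := leP `|y + phi e|%R t.
  by rewrite addeC; apply: IHk => //; exact: ltnW.
(* First exit: the position has norm at most [t + a], and the remaining [k] steps add at most [m] in
   mean. Reflection gives an exceedance probability of at least 1/2, whence the factor 2 in
   [2 * (a + m)]. *)
apply: (le_trans (Lk k _ 0%R)); rewrite subr0.
apply: (@le_trans _ _ (m + (t + a))%:E).
  rewrite EFinD leeD//; first by rewrite mk// ltnW.
  by rewrite lee_fin (le_trans (ler_normD _ _))// lerD.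
have h := iter_avg_exceeds_reflect k 0%R mphi sphi yt'.
rewrite addr0 subr0 in h.
have {}h : 2^-1%:E <= iter k (avg nu phi) (exceeds t) (y + phi e)%R.
  by apply: lee_double; rewrite -EFinD (_ : 2^-1 + 2^-1 = 1)%R//; field.
rewrite (_ : m + (t + a) = (2 * (a + m)) * 2^-1 + t)%R; last by field.
by rewrite EFinD leeD2r// EFinM lee_wpmul2l// lee_fin.
Qed.

Lemma iter_avg_norm_bound phi (a t p : R) n : measurable_fun [set: E] phi ->
  sign_invariant phi -> (0 <= a)%R -> (0 <= t)%R ->
  (forall e, (`|phi e : B| <= a)%R) -> (p <= 4^-1)%R ->
  iter n (avg nu phi) (exceeds t) 0%R <= p%:E ->
  iter n (avg nu phi) (@norm_ereal R B) 0%R <= (2 * t + 4 * a * p)%:E.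
Proof.
move=> mphi sphi a0 t0 phia p4 Gp.
have := fun m => @iter_avg_norm_le_exceeds phi a t m n mphi sphi a0 t0 phia.
have := iter_avg_norm_le n mphi a0 phia.
have := (@nonneg_borel_iter_avg _ _ _ _ nu separableB phi _ n mphi (@nonneg_borel_norm R B)).2 0%R.
case: (iter n _ _ 0%R) => [m||]//=.
rewrite !lee_fin => m0 _ /(_ _ erefl) mle.
have : m%:E <= (t + (2 * (a + m)) * p)%:E.
  apply: (le_trans mle); rewrite (EFinD t) leeD2l//.
  rewrite (EFinM (2 * (a + m))%R p); apply: lee_wpmul2l => //.
  by rewrite lee_fin mulr_ge0// addr_ge0.
(* As [p <= 1/4], the term [2 * m * p] is at most [m / 2] and is absorbed on the left. *)
rewrite lee_fin; nra.
Qed.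

(** A Levy-type inequality: [1 - (1 - q) ^+ n] is the probability that some step is longer than [t],
    and reflecting such a step puts the sum outside the ball for at least one of its two signs. *)
Lemma iter_avg_exceeds_of_step phi (t q : R) n y : measurable_fun [set: E] phi ->
  sign_invariant phi -> nu [set e | (t < `|phi e : B|)%R] = q%:E ->
  (1 - (1 - q) ^+ n)%:E <=
  iter n (avg nu phi) (exceeds t) y + iter n (avg nu phi) (exceeds t) y.
Proof.
move=> mphi sphi nuq.
set W := [set e | _] in nuq.
have mW : measurable W.
  have := mphi measurableT _ (measurable_exceeds_set t); rewrite setTI; exact.
have q01 : (0 <= q <= 1)%R.
  by rewrite -!lee_fin -nuq measure_ge0 probability_le1.
have bG := @nonneg_borel_exceeds R B t.
have bk k := @nonneg_borel_iter_avg _ _ _ _ nu separableB phi _ k mphi bG.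
(* The long step [phi e] changes sign while the other steps, collected in [z], are the same on both
   sides. Since [exceeds t] is even, [z - phi e] may be replaced by [phi e - z], and [phi e] is the
   midpoint. *)
have far k z e : W e -> 1 <= iter k (avg nu phi) (exceeds t) (z + phi e)%R +
                            iter k (avg nu phi) (exceeds t) (z - phi e)%R.
  move=> We; elim: k z => [|k IHk] z /=.
    have -> : exceeds t (z - phi e)%R = exceeds t (phi e - z)%R.
      by rewrite !exceedsE distrC.
    by rewrite (addrC z); exact: exceeds_reflect.
  rewrite avgD//; apply: integral_ge_cst => //; first exact: measurable_translateD.
  by move=> e'; rewrite (addrAC z) (addrAC z (- phi e)%R); exact: IHk.
elim: n y => [|n IHn] y /=.
  by rewrite expr0 subrr adde_ge0//; exact: bG.2.
rewrite avg_double//.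
pose r := (1 - (1 - q) ^+ n)%R.
(* The next bound is the mean of a function equal to 1 on [W] (first step long) and to [r] off [W]
   (induction hypothesis). *)
have r01 : (0 <= r <= 1)%R.
  by rewrite /r subr_ge0 gerBl exprn_ge0 ?exprn_ile1//=; lra.
rewrite (_ : 1 - (1 - q) ^+ n.+1 = (1 - r) * q + r)%R; last by rewrite /r exprS; ring.
have r10 : (0 <= 1 - r)%R by lra.
have r0 : (0 <= r)%R by lra.
have mI : measurable_fun [set: E] (fun e => (\1_W e : R)%:E).
  by apply/measurable_EFinP; exact: measurable_indic.
have mrI : measurable_fun [set: E] (fun e => (1 - r)%:E * (\1_W e)%:E).
  exact: measurable_funeM.
have rI0 e : 0 <= (1 - r)%:E * (\1_W e)%:E by rewrite mule_ge0// lee_fin.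
have -> : ((1 - r) * q + r)%:E = \int[nu]_e ((1 - r)%:E * (\1_W e)%:E + r%:E).
  rewrite integralD_cst// ge0_integralZl_EFin//.
  have -> : \int[nu]_e (\1_W e)%:E = q%:E by rewrite integral_indic// setIT; exact: nuq.
  by [].
apply: ge0_le_integral => //.
- by move=> e _; rewrite adde_ge0// lee_fin.
- by apply: emeasurable_funD => //; exact: measurable_cst.
- by apply: measurable_translateD => //; exact: measurable_opp.
move=> e _; rewrite indicE; case: (boolP (e \in W)) => [|_].
  by rewrite inE mule1 -EFinD subrK; exact: far.
rewrite mule0 add0e; have h1 := IHn (y + phi e)%R; have h2 := IHn (y - phi e)%R.
apply: lee_double; rewrite -/r in h1 h2.
by apply: (le_trans (leeD h1 h2)); rewrite addeACA.
Qed.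

End SymmetricAverages.

(** * Bochner integral of bounded functions *)

Section SimpleIntegral.
Local Open Scope ereal_scope.
Context {R : realType} {B : completeNormedModType R}.
Context d (T : measurableType d) (P : probability T R).

Lemma integral_finite_range (V : choiceType) (F : {fset V}) (Z : T -> V) (h : V -> R) :
  (forall w, Z w \in F) -> (forall z, measurable (Z @^-1` [set z])) ->
  (forall z, 0 <= h z)%R ->
  \int[P]_w (h (Z w))%:E = (\sum_(z <- F) h z * fine (P (Z @^-1` [set z])))%:E.
Proof.
move=> ZF mZ h0.
transitivity (\int[P]_w \sum_(z <- F) ((h z)%:E * (\1_(Z @^-1` [set z]) w)%:E)).
  apply: eq_integral => w _; rewrite (big_fsetD1 (Z w))//= big_seq big1.
    by rewrite adde0 indicE mem_set// mule1.
  move=> z; rewrite in_fsetD1 => /andP[zZ _]; rewrite indicE memNset ?mule0//.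
  by move=> /= Zz; rewrite -Zz eqxx in zZ.
have mI z : measurable_fun [set: T] (fun w => (\1_(Z @^-1` [set z]) w : R)%:E).
  by apply/measurable_EFinP; exact: measurable_indic.
rewrite ge0_integral_sum//; last 2 first.
- by move=> z; exact: measurable_funeM.
- by move=> z w _; rewrite mule_ge0// lee_fin.
rewrite -sumEFin; apply: eq_bigr => z _.
rewrite ge0_integralZl_EFin//.
by rewrite integral_indic// setIT EFinM fineK// fin_num_measure.
Qed.

(** Allows a simple integral to be computed on any finer finite partition, here the fibers of [Z],
    so that two simple functions can share one. *)
Lemma simple_integral_comp (V : choiceType) (F : {fset V}) (Z : T -> V) (g : V -> B) :
  (forall w, Z w \in F) -> (forall z, measurable (Z @^-1` [set z])) ->
  simple_integral P (fun w => g (Z w)) =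
  (\sum_(z <- F) fine (P (Z @^-1` [set z])) *: g z)%R.
Proof.
move=> ZF mZ; rewrite (partition_big_imfset _ g).
rewrite /simple_integral (@fsbig_widen _ _ _ _ (range (fun w => g (Z w)))
  [set` [fset g x | x in F]%fset]) //=; last 2 first.
- by move=> _ [w _ <-] /=; rewrite in_imfset//; exact: ZF.
- move=> v [_ /= nv]; rewrite (_ : _ @^-1` _ = set0) ?measure0 ?scale0r//.
  by apply/seteqP; split => // w /= wv; apply: nv; exists w.
rewrite -fsbig_seq//; apply: eq_bigr => v _.
rewrite (eq_bigr (fun z => fine (P (Z @^-1` [set z])) *: v)%R); last first.
  by move=> z /eqP gz; rewrite gz.
rewrite -scaler_suml; congr (_ *: _)%R.
have -> : (\sum_(z <- F | g z == v) fine (P (Z @^-1` [set z])) =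
  \sum_(z <- F) (g z == v)%:R * fine (P (Z @^-1` [set z])))%R.
  rewrite big_mkcond/=; apply: eq_bigr => z _.
  by case: ifP => _; rewrite ?mul1r ?mul0r.
apply: EFin_inj; rewrite -(@integral_finite_range _ F Z (fun z => (g z == v)%:R))//.
pose W := \bigcup_(z in [set z | z \in F /\ g z = v]) (Z @^-1` [set z]).
have -> : (fun w => g (Z w)) @^-1` [set v] = W.
  apply/seteqP; split => w /=; first by move=> gw; exists (Z w).
  by move=> [z [_ gz] /= Zz]; rewrite Zz.
have mW : measurable W.
  apply: fin_bigcup_measurable => //.
  by apply: (sub_finite_set _ (finite_fset F)) => z [].
rewrite fineK ?fin_num_measure// -[W in P W]setIT -(integral_indic _ measurableT)//.
apply: eq_integral => w _; rewrite indicE; congr (nat_of_bool _)%:R%:E.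
apply/idP/eqP; first by rewrite inE => -[z [_ <-] /= ->].
by move=> gw; rewrite inE; exists (Z w).
Qed.

Lemma measurable_set1_borel (v : B) : measurable ([set v] : set (borel B)).
Proof.
rewrite -(setCK [set v]); apply: measurableC; apply: open_measurable_borel.
exact/closed_openC/accessible_closed_set1/hausdorff_accessible/norm_hausdorff.
Qed.

Lemma measurable_fiber (s : T -> borel B) v : measurable_fun [set: T] s ->
  measurable (s @^-1` [set v]).
Proof.
by move=> ms; have := ms measurableT _ (measurable_set1_borel v); rewrite setTI.
Qed.

Lemma simple_integral_sub (s1 s2 : T -> borel B) :
  measurable_fun [set: T] s1 -> measurable_fun [set: T] s2 ->
  finite_set (range s1) -> finite_set (range s2) ->
  `|simple_integral P s1 - simple_integral P s2|%:E <= \int[P]_w `|s1 w - s2 w|%:E.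
Proof.
(* The pair provides the common refinement of the two partitions. *)
move=> ms1 ms2 fs1 fs2; pose Z w : B * B := (s1 w, s2 w).
have fZ : finite_set (range Z).
  by apply: (sub_finite_set _ (finite_setX fs1 fs2)) => _ [w _ <-]; split; exists w.
pose F := fset_set (range Z).
have ZF w : Z w \in F by rewrite in_fset_set// inE; exists w.
have mZ z : measurable (Z @^-1` [set z]).
  rewrite (_ : _ @^-1` _ = s1 @^-1` [set z.1] `&` s2 @^-1` [set z.2]).
    by apply: measurableI; exact: measurable_fiber.
  apply/seteqP; split => w /=; first by move=> <-.
  by case: z => z1 z2 /= [<- <-].
rewrite (@simple_integral_comp _ F Z fst)// (@simple_integral_comp _ F Z snd)//.
rewrite (@integral_finite_range _ F Z (fun z => `|z.1 - z.2|%R))//.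
rewrite -sumrB lee_fin (le_trans (ler_norm_sum _ _ _))//.
apply: ler_sum => z _; rewrite -scalerBr normrZ mulrC ger0_norm//.
exact: fine_ge0.
Qed.

Lemma simple_integral_jensen (s : T -> borel B) x :
  measurable_fun [set: T] s -> finite_set (range s) ->
  `|x - simple_integral P s|%:E <= \int[P]_w `|x - s w|%:E.
Proof.
move=> ms fs; have sx : simple_integral P (cst x : T -> B) = x.
  rewrite (@simple_integral_comp _ [fset x]%fset (cst x) id).
  - by rewrite big_seq_fset1 preimage_cst mem_set//= probability_setT scale1r.
  - by move=> w; rewrite in_fset1.
  - by move=> z; apply: measurable_fiber; exact: measurable_cst.
have fx : finite_set (range (cst x : T -> B)).
  by apply: (sub_finite_set _ (finite_set1 x)) => _ [w _ <-].
have mx : measurable_fun [set: T] (cst x : T -> borel B) by exact: measurable_cst.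
by have := simple_integral_sub mx ms fx fs; rewrite sx.
Qed.

End SimpleIntegral.

(** * Existence of the Bochner integral and Jensen's inequality for the norm *)

Section BochnerExpectation.
Local Open Scope ereal_scope.
Context {R : realType} {B : completeNormedModType R}.
Hypothesis separableB : separable_space B.
Context d (T : measurableType d) (P : probability T R).

Lemma measurable_addB d' (E : measurableType d') (u v : E -> borel B) :
  measurable_fun [set: E] u -> measurable_fun [set: E] v ->
  measurable_fun [set: E] (fun e => (u e + v e)%R : borel B).
Proof.
move=> mu mv.
exact: (measurableT_comp (measurable_add separableB) (measurable_fun_pair mu mv)).
Qed.

Lemma measurable_subB d' (E : measurableType d') (u v : E -> borel B) :
  measurable_fun [set: E] u -> measurable_fun [set: E] v ->
  measurable_fun [set: E] (fun e => (u e - v e)%R : borel B).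
Proof.
by move=> mu mv; apply: (measurable_addB mu); exact: measurable_opp.
Qed.

Lemma measurable_normB d' (E : measurableType d') (u v : E -> borel B) :
  measurable_fun [set: E] u -> measurable_fun [set: E] v ->
  measurable_fun [set: E] (fun e => `|(u e : B) - v e|%R%:E).
Proof.
move=> mu mv; apply: (@measurable_shift _ _ separableB _ _ u (fun e => - v e)%R
  (@norm_ereal R B)) => //; first exact: measurable_opp.
exact: nonneg_borel_norm.
Qed.

(** [s k] sends [w] to a nearest point to [U w] among the first [k + 1] terms of a dense sequence.
    Density gives pointwise convergence, and the distance to the first term gives a dominating
    constant. *)
Lemma simple_approximation (U : T -> borel B) (M : R) :
  measurable_fun [set: T] U -> (forall w, (`|U w : B| <= M)%R) ->
  exists s : nat -> T -> B,
    [/\ forall k, measurable_fun [set: T] (s k : T -> borel B),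
        forall k, finite_set (range (s k)) &
        \int[P]_w (`|U w - s k w|)%:E @[k --> \oo] --> 0].
Proof.
move=> mU UM; have [D [cD dD]] := separableB.
have [D0|[e]] := pfcard_geP cD.
  have [x [_]] : [set: B] `&` D !=set0 by apply: dD; [exists 0%R|exact: openT].
  by rewrite D0.
have eD : range e = D by exact/image_eq.
pose s := fix s k : T -> B := if k is j.+1 then
    fun w => if (`|(U w : B) - e k| < `|(U w : B) - s j w|)%R then e k else s j w
  else cst (e 0%N).
have sS k w : s k.+1 w =
    if (`|(U w : B) - e k.+1| < `|(U w : B) - s k w|)%R then e k.+1 else s k w by [].
have ms k : measurable_fun [set: T] (s k : T -> borel B).
  elim: k => [|k IHk]; first exact: measurable_cst.
  apply: measurable_fun_ifT => //.
  apply: measurable_fun_ltr.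
    by apply/measurable_EFinP; apply: measurable_normB => //; exact: measurable_cst.
  by apply/measurable_EFinP; exact: measurable_normB.
have fs k : finite_set (range (s k)).
  elim: k => [|k IHk].
    by apply: (sub_finite_set _ (finite_set1 (e 0%N))) => _ [w _ <-].
  apply: (@sub_finite_set _ _ (e k.+1 |` range (s k))); last by rewrite finite_setU; split.
  by move=> _ [w _ <-]; rewrite sS; case: ifP => _; [left|right; exists w].
have sle k w i : (i <= k)%N -> (`|(U w : B) - s k w| <= `|(U w : B) - e i|)%R.
  elim: k => [|k IHk]; first by rewrite leqn0 => /eqP ->.
  rewrite leq_eqVlt sS => /orP[/eqP ->|]; first by case: ltP => // /ltW.
  by rewrite ltnS => /IHk ik; case: ltP => // /ltW h; exact: le_trans h ik.
have scvg w : (`|(U w : B) - s k w|%R)%:E @[k --> \oo] --> 0.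
  apply/fine_cvgP; split; first exact: nearW.
  apply/cvgrPdist_lt => eps eps0.
  have [x [Ux]] := dD (ball (U w : B) eps) (ex_intro _ _ (ballxx _ eps0))
    (ball_open _ _).
  rewrite -eD => -[i _ eix]; exists i => // k /= ik.
  rewrite sub0r normrN normr_id (le_lt_trans (sle _ _ _ ik))// eix.
  by move: Ux; rewrite -ball_normE.
exists s; split => //.
have := @dominated_convergence _ T R P setT measurableT
  (fun k w => (`|(U w : B) - s k w|%R)%:E) (cst 0) (cst (M + `|e 0%N|)%:E).
case.
- by move=> k; exact: measurable_normB.
- exact: measurable_cst.
- by apply: aeW => w _; exact: scvg.
- exact: finite_measure_integrable_cst.
- apply: aeW => w k _; rewrite gee0_abs// lee_fin (le_trans (sle k w 0%N _))//.
  by rewrite (le_trans (ler_normB _ _))// lerD2r.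
by move=> _ _; rewrite /= integral0.
Qed.

(** The simple integrals are Cauchy, because they differ by at most the mean distance of the
    approximants; completeness supplies the limit. *)
Lemma bochner_integral_exists (U : T -> borel B) (M : R) :
  measurable_fun [set: T] U -> (forall w, (`|U w : B| <= M)%R) ->
  exists v, is_bochner_integral P U v.
Proof.
move=> mU UM; have [s [ms fs scvg]] := simple_approximation mU UM.
have s_cvg : cvg (simple_integral P (s k) @[k --> \oo]).
  apply/cauchy_cvgP/cauchy_exP => eps eps0.
  have /fine_cvgP[sfin /cvgrPdist_lt] := scvg.
  move=> /(_ (eps / 2)%R ltac:(by rewrite divr_gt0)).
  move: sfin => [N1 _ sfin] [N2 _ sN].
  have H k : (maxn N1 N2 <= k)%N -> \int[P]_w (`|U w - s k w|)%:E < (eps / 2)%:E.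
    rewrite geq_max => /andP[k1 k2].
    rewrite -(fineK (sfin k k1)) lte_fin (le_lt_trans (ler_norm _))//.
    by have := sN k k2; rewrite /= sub0r normrN.
  pose x := maxn N1 N2; exists (simple_integral P (s x)); exists x => // y yN.
  rewrite /= -ball_normE /= -lte_fin.
  apply: (le_lt_trans (simple_integral_sub P (ms x) (ms y) (fs x) (fs y))).
  rewrite (_ : eps = eps / 2 + eps / 2)%R; last by field.
  rewrite EFinD; apply: le_lt_trans (lteD (H x (leqnn x)) (H y yN)).
  rewrite -ge0_integralD//; try exact: measurable_normB.
  apply: ge0_le_integral => //.
  - exact: measurable_normB.
  - by apply: emeasurable_funD; exact: measurable_normB.
  move=> w _; rewrite -EFinD lee_fin (distrC (U w : B)).
  by rewrite (le_trans _ (ler_normD _ _))// addrA subrK.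
exists (lim (simple_integral P (s k) @[k --> \oo])); split => //.
by exists s; split.
Qed.

Lemma bochner_integral_jensen (U : T -> borel B) v x :
  is_bochner_integral P U v -> `|x - v|%:E <= \int[P]_w `|x - U w|%:E.
Proof.
move=> [mU [s [ms fs /fine_cvgP[sfin /cvgrPdist_lt scvg] vcvg]]].
have mxU : measurable_fun [set: T] (fun w => `|x - U w|%:E).
  by apply: (@measurable_normB _ _ (cst x)) => //; exact: measurable_cst.
apply/lee_addgt0Pr => eps eps0.
have e2 : (0 < eps / 2)%R by rewrite divr_gt0.
have /cvgrPdist_lt/(_ _ e2) vN := vcvg.
near \oo => k.
have h1 : (`|v - simple_integral P (s k)| < eps / 2)%R by near: k.
have h2 : \int[P]_w `|U w - s k w|%:E <= (eps / 2)%:E.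
  have kfin : \int[P]_w `|U w - s k w|%:E \is a fin_num by near: k.
  rewrite -(fineK kfin) lee_fin (le_trans (ler_norm _))// ltW//.
  rewrite -normrN -[X in (`|X| < _)%R]add0r.
  by near: k; exact: scvg.
have msU : measurable_fun [set: T] (fun w => `|U w - s k w|%:E) by exact: measurable_normB.
have h3 : `|x - simple_integral P (s k)|%:E <= \int[P]_w `|x - U w|%:E + (eps / 2)%:E.
  apply: (le_trans (simple_integral_jensen P x (ms k) (fs k))).
  apply: le_trans (leeD2l _ h2).
  rewrite -ge0_integralD//.
  apply: ge0_le_integral => //.
  - by apply: (@measurable_normB _ _ (cst x)) => //; exact: measurable_cst.
  - exact: emeasurable_funD.
  move=> w _; rewrite -EFinD lee_fin.
  by rewrite (le_trans _ (ler_normD _ _))// addrA subrK.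
rewrite (_ : eps = eps / 2 + eps / 2)%R; last by field.
move: (\int[P]_w `|x - U w|%:E) h3 => J h3.
rewrite EFinD addeA; apply: le_trans (leeD2r _ h3).
rewrite -EFinD lee_fin -(subrK (simple_integral P (s k)) x) -addrA.
by rewrite (le_trans (ler_normD _ _))// subrK lerD2l distrC ltW.
Unshelve. all: by end_near. Qed.

End BochnerExpectation.

(** * Independent copies *)

Section IndependentCopies.
Local Open Scope ereal_scope.
Context {R : realType} {B : completeNormedModType R}.
Hypothesis separableB : separable_space B.
Context d (T : measurableType d) (P : probability T R).

(** Exchanging the coordinates preserves the product measure, by integrating in the two orders, and
    turns [h] into its opposite. *)
Lemma sign_invariant_swap (h : T * T -> borel B) :
  measurable_fun [set: T * T] h -> (forall x y, h (y, x) = - (h (x, y) : B))%R ->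
  sign_invariant (P \x P) h.
Proof.
move=> mh hswap f y bf; rewrite /avg.
rewrite fubini_tonelli1; [|exact: measurable_translate|by move=> p; exact: bf.2].
rewrite fubini_tonelli2; last 2 first.
- apply: (@measurable_translate _ _ _ _ separableB (fun p => - h p)%R f) => //.
  exact: measurable_opp.
- by move=> p; exact: bf.2.
apply: eq_integral => u _; rewrite /fubini_F /fubini_G.
by apply: eq_integral => v _ /=; rewrite hswap.
Qed.

Lemma avg_jensen d' (E : measurableType d') (nu : probability E R)
    (psi : E -> borel B) (U : T -> borel B) (v : B) f :
  measurable_fun [set: E] psi -> measurable_fun [set: T] U -> nonneg_borel f ->
  (forall x, f (x - v)%R <= \int[P]_w f (x - U w)%R) ->
  forall x, avg nu psi f (x - v)%R <= \int[P]_w avg nu psi f (x - U w)%R.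
Proof.
move=> mpsi mU bf Jf x.
have mF : measurable_fun [set: T * E] (fun p => f (x - U p.1 + psi p.2)%R).
  apply: (@measurable_shift _ _ separableB _ _ (fun p => x - U p.1)%R
    (fun p => psi p.2)) => //; last exact: (measurableT_comp mpsi).
  by apply: (@measurable_subB _ _ separableB _ _ (cst x)) => //; exact: measurableT_comp.
rewrite /avg (@fubini_tonelli _ _ _ _ _ P nu (fun p => f (x - U p.1 + psi p.2)%R))//;
  last by move=> p; exact: bf.2.
apply: ge0_le_integral => //.
- by move=> e _; exact: bf.2.
- exact: measurable_translate.
- apply: (@measurable_fun_fubini_tonelli_G _ _ _ _ _ P
    (fun p => f (x - U p.1 + psi p.2)%R)) => // p; exact: bf.2.
move=> e _; rewrite (addrAC x) (le_trans (Jf _))//.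
by under eq_integral do rewrite (addrAC x (psi e)).
Qed.

(** Jensen's inequality replaces [v] by an independent copy of [U], one step at a time; [Jk] says
    that averages along the symmetrized walk still satisfy it. *)
Lemma iter_avg_centered (U : T -> borel B) (v : B) n y :
  measurable_fun [set: T] U ->
  (forall x, `|x - v|%:E <= \int[P]_w `|x - U w|%:E) ->
  iter n (avg P (fun w => U w - v)%R) (@norm_ereal R B) y <=
  iter n (avg (P \x P) (fun p => U p.1 - U p.2)%R) (@norm_ereal R B) y.
Proof.
move=> mU Jv; have bN := @nonneg_borel_norm R B.
have mUv : measurable_fun [set: T] (fun w => (U w - v)%R : borel B).
  by apply: (measurable_subB separableB mU); exact: measurable_cst.
have mUU : measurable_fun [set: T * T] (fun p => (U p.1 - U p.2)%R : borel B).
  by apply: measurable_subB => //; exact: (measurableT_comp mU).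
have bk k := @nonneg_borel_iter_avg _ _ _ _ (P \x P) separableB _ _ k mUU bN.
have Jk k x : iter k (avg (P \x P) (fun p => U p.1 - U p.2)%R) (@norm_ereal R B) (x - v)%R <=
   \int[P]_w iter k (avg (P \x P) (fun p => U p.1 - U p.2)%R) (@norm_ereal R B) (x - U w)%R.
  elim: k x => [|k IHk] x /=; first exact: Jv.
  exact: avg_jensen.
elim: n y => //= n IHn y.
apply: (le_trans (@le_avg _ _ _ _ P separableB _ _ _ mUv
  (nonneg_borel_iter_avg P separableB n mUv bN) (bk n) IHn y)).
rewrite /avg fubini_tonelli1; last 2 first.
- by have := @measurable_translate _ _ _ _ separableB _ _ y mUU (bk n).
- by move=> p; exact: (bk n).2.
rewrite /fubini_F /=; apply: ge0_le_integral => //.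
- by move=> w _; exact: (bk n).2.
- by have := @measurable_translate _ _ _ _ separableB _ _ y mUv (bk n).
- apply: (@measurable_fun_fubini_tonelli_F _ _ _ _ _ P (fun p =>
    iter n (avg (P \x P) (fun p => U p.1 - U p.2)%R) (@norm_ereal R B) (y + (U p.1 - U p.2))%R)).
    by have := @measurable_translate _ _ _ _ separableB _ _ y mUU (bk n).
  by move=> p; exact: (bk n).2.
move=> w _; rewrite addrA (le_trans (Jk n _))//.
by under eq_integral do rewrite -addrA.
Qed.

Context (X : nat -> T -> borel B).
Hypothesis mX : forall n, measurable_fun [set: T] (X n).
Hypothesis iidX : iid P X.

Let Z i (p : T * T) : borel B * borel B := (X i p.1, X i p.2).

Let mX1 i : measurable_fun [set: T * T] (X i \o fst).
Proof. exact: measurableT_comp. Qed.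

Let mX2 i : measurable_fun [set: T * T] (X i \o snd).
Proof. exact: measurableT_comp. Qed.

Let mZ i : measurable_fun [set: T * T] (Z i).
Proof. exact: (measurable_fun_pair (mX1 i) (mX2 i)). Qed.

Let mXpre i A : measurable A -> measurable (X i @^-1` A).
Proof. by move=> mA; have := mX i measurableT mA; rewrite setTI. Qed.

Let mZpre i M : measurable M -> measurable (Z i @^-1` M).
Proof. by move=> mM; have := mZ i measurableT mM; rewrite setTI. Qed.

Let Zrect i A1 A2 : measurable A1 -> measurable A2 ->
  (P \x P) (Z i @^-1` (A1 `*` A2)) = P (X i @^-1` A1) * P (X i @^-1` A2).
Proof.
move=> mA1 mA2; rewrite -product_measure1E; [|exact: mXpre|exact: mXpre].
by congr ((P \x P) _).
Qed.

Let pair_law i (m1 m2 : probability (borel B) R) M :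
  (forall A, measurable A -> P (X i @^-1` A) = m1 A) ->
  (forall A, measurable A -> P (X i @^-1` A) = m2 A) ->
  measurable M -> (P \x P) (Z i @^-1` M) = (m1 \x m2) M.
Proof.
move=> m1E m2E mM; rewrite -[RHS]mul1e -[Z i @^-1` M]setIT.
apply: (@joint_law _ _ _ _ _ _ _ (P \x P) (X i \o fst) (X i \o snd)) => //.
by move=> A1 A2 mA1 mA2; rewrite setIT mul1e -m1E// -m2E// -Zrect.
Qed.

(** The list [s] holds the indices at which [M i] may fail to be a rectangle. With none,
    independence factors through the two coordinates; each induction step frees one more index. *)
Let pairs_independent (s : seq nat) (J : {fset nat}) (M : nat -> set (borel B * borel B)) :
  (forall i, measurable (M i)) ->
  (forall i, i \in J -> i \notin s -> exists A,
     [/\ measurable A.1, measurable A.2 & M i = A.1 `*` A.2]) ->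
  (P \x P) (\bigcap_(i in [set` J]) (Z i @^-1` M i)) =
  \big[*%E/1]_(i <- J) (P \x P) (Z i @^-1` M i).
Proof.
elim: s J M => [|k s IHs] J M mM rM.
  have /choice[A AP] : forall i, exists A : set (borel B) * set (borel B),
      i \in J -> [/\ measurable A.1, measurable A.2 & M i = A.1 `*` A.2].
    move=> i; have [iJ|] := boolP (i \in J); last by exists (set0, set0).
    by have [A ?] := rM i iJ isT; exists A.
  pose A1 i := if i \in J then (A i).1 else setT.
  pose A2 i := if i \in J then (A i).2 else setT.
  have mA1 i : measurable (A1 i) by rewrite /A1; case: ifP => // /AP[].
  have mA2 i : measurable (A2 i) by rewrite /A2; case: ifP => // /AP[].
  have ME i : i \in J -> M i = A1 i `*` A2 i.
    by move=> iJ; rewrite /A1 /A2 iJ; have [] := AP i iJ.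
  rewrite (_ : \bigcap_(i in _) _ = \bigcap_(i in [set` J]) (X i @^-1` A1 i) `*`
      \bigcap_(i in [set` J]) (X i @^-1` A2 i)); last first.
    apply/seteqP; split => p /= => [H|[H1 H2] i iJ].
      by split => i iJ; have := H i iJ; rewrite /= ME// => -[].
    by rewrite /= ME//; split; [exact: H1|exact: H2].
  transitivity (P (\bigcap_(i in [set` J]) (X i @^-1` A1 i)) *
      P (\bigcap_(i in [set` J]) (X i @^-1` A2 i))).
    by apply: product_measure1E; exact: measurable_bigcap_preimage.
  rewrite (iidX.1 J A1 mA1) (iidX.1 J A2 mA2) -big_split/=.
  by rewrite !big_seq; apply: eq_bigr => i iJ; rewrite ME// Zrect.
have [kJ|kJ] := boolP (k \in J); last first.
  apply: IHs => // i iJ nis; apply: rM => //; rewrite inE negb_or nis andbT.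
  by apply: contraNneq kJ => <-.
pose J' := (J `\ k)%fset; pose E := \bigcap_(i in [set` J']) (Z i @^-1` M i).
have JE : J = (k |` J')%fset by rewrite fsetD1K.
have kJ' : k \notin J' by rewrite in_fsetD1 eqxx.
have mE : measurable E by apply: fin_bigcap_measurable => // i _; exact: mZpre.
have capJ (N : nat -> set (borel B * borel B)) : (forall i, i \in J' -> N i = M i) ->
    \bigcap_(i in [set` J]) (Z i @^-1` N i) = Z k @^-1` N k `&` E.
  move=> NM; apply/seteqP; split => p.
    move=> Np; split; first exact: (Np k kJ).
    by move=> i /= iJ'; rewrite -NM//; apply: Np; rewrite /= JE in_fset1U iJ' orbT.
  move=> [Nk Ep] i /=; rewrite JE in_fset1U => /orP[/eqP->//|iJ'].
  by rewrite NM//; exact: Ep.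
have rJ' i : i \in J' -> i \notin s -> exists A,
     [/\ measurable A.1, measurable A.2 & M i = A.1 `*` A.2].
  rewrite in_fsetD1 => /andP[ik iJ] nis; apply: rM => //.
  by rewrite inE negb_or ik.
have PE : (P \x P) E = \big[*%E/1]_(i <- J') (P \x P) (Z i @^-1` M i) by exact: IHs.
pose mk : probability (borel B) R := distribution P (mfun_of (mX k)).
(* Index [k] is isolated against the event [E] of the other indices. By [joint_law] a rectangle at
   [k] suffices, and that case is the induction hypothesis. *)
rewrite capJ// {1}JE big_fsetU1//= -PE muleC.
rewrite (@pair_law k mk mk)//.
apply: (@joint_law _ _ _ _ _ _ _ (P \x P) (X k \o fst) (X k \o snd)) => //.
  exact: (fin_num_measure ((P \x P) : probability (T * T)%type R)).
move=> A1 A2 mA1 mA2.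
pose N i := if i == k then A1 `*` A2 else M i.
have NM i : i \in J' -> N i = M i.
  by move=> iJ'; rewrite /N ifN//; apply: contraNneq kJ' => <-.
have Nk : N k = A1 `*` A2 by rewrite /N eqxx.
transitivity ((P \x P) (\bigcap_(i in [set` J]) (Z i @^-1` N i))).
  by rewrite capJ// Nk.
have mN i : measurable (N i) by rewrite /N; case: (i == k) => //; exact: measurableX.
rewrite (IHs J N mN); last first.
  move=> i; rewrite {1}JE in_fset1U => /orP[/eqP->|iJ'] nis.
    by exists (A1, A2); split => //=.
  by rewrite NM//; exact: rJ'.
rewrite {1}JE big_fsetU1//= Nk Zrect// muleC; congr (_ * _).
by rewrite PE !big_seq; apply: eq_bigr => i iJ'; rewrite NM.
Qed.

Lemma iid_independent_copies (h : borel B * borel B -> borel B) :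
  measurable_fun [set: borel B * borel B] h ->
  iid (P \x P) (fun i p => h (X i p.1, X i p.2)).
Proof.
move=> mh.
have mhpre A : measurable A -> measurable (h @^-1` A).
  by move=> mA; have := mh measurableT _ mA; rewrite setTI.
split => [J A mA|n A mA].
  by apply: (pairs_independent (s := enum_fset J) (M := fun i => h @^-1` A i)) => [i|i -> //];
    exact: mhpre.
pose m0 : probability (borel B) R := distribution P (mfun_of (mX 0)).
have XE i C : measurable C -> P (X i @^-1` C) = m0 C by move=> mC; exact: iidX.2.
transitivity ((m0 \x m0) (h @^-1` A)).
  exact: (pair_law (XE n) (XE n) (mhpre _ mA)).
by apply/esym; exact: (pair_law (XE 0%N) (XE 0%N) (mhpre _ mA)).
Qed.

End IndependentCopies.

(** * Tails of sums *)

Section ConvergenceToZero.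
Context {R : realType}.

Lemma cvge0P (u : nat -> \bar R) : (forall n, 0 <= u n)%E ->
  u n @[n --> \oo] --> 0%E <->
  (forall e : R, 0 < e -> \forall n \near \oo, (u n <= e%:E)%E).
Proof.
move=> u0; split.
  move=> /fine_cvgP[ufin /cvgrPdist_le ucvg] e e0.
  near=> n; have unfin : u n \is a fin_num by near: n.
  rewrite -(fineK unfin) lee_fin (le_trans (ler_norm _))// -normrN -[X in `|X| <= _]add0r.
  by near: n; exact: ucvg.
move=> H; apply/fine_cvgP; split.
  have [N _ HN] := H 1 ltr01; exists N => // n /HN un1.
  by rewrite ge0_fin_numE// (le_lt_trans un1)// ltry.
apply/cvgrPdist_le => e e0; near=> n.
have une : (u n <= e%:E)%E by near: n; exact: H.
rewrite sub0r normrN ger0_norm ?fine_ge0// -lee_fin fineK//.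
by rewrite ge0_fin_numE// (le_lt_trans une)// ltry.
Unshelve. all: by end_near. Qed.

(** From [(1 - q) ^+ n * (1 + n q) <= 1] and [(1 - q) ^+ n >= 1 - s >= 1/2], one gets
    [n q / 2 <= 1 - (1 - q) ^+ n <= s]. *)
Lemma bernoulli_tail (q s : R) n : 0 <= q <= 1 -> s <= 2^-1 ->
  1 - (1 - q) ^+ n <= s -> n%:R * q <= 2 * s.
Proof.
move=> /andP[q0 q1] s2 qs.
have H : (1 - q) ^+ n * (1 + n%:R * q) <= 1.
  elim: n {qs} => [|n IHn]; first by rewrite expr0 mul0r addr0 mulr1.
  apply: le_trans IHn; rewrite exprSr -mulrA ler_wpM2l ?exprn_ge0 ?subr_ge0//.
  have n0 : 0 <= n%:R :> R by [].
  rewrite -natr1; nra.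
have n0 : 0 <= n%:R * q by rewrite mulr_ge0.
move: (n%:R * q) ((1 - q) ^+ n) n0 qs H => m r m0 qs H.
nra.
Qed.

End ConvergenceToZero.

Section RandomWalkTails.
Local Open Scope ereal_scope.
Context {R : realType} {B : completeNormedModType R}.
Hypothesis separableB : separable_space B.

Lemma iid_comp d (T : measurableType d) (P : probability T R)
    (X : nat -> T -> borel B) (g : borel B -> borel B) :
  measurable_fun [set: borel B] g -> iid P X -> iid P (fun i w => g (X i w)).
Proof.
move=> mg [indepX sameX].
have mgpre A : measurable A -> measurable (g @^-1` A).
  by move=> mA; have := mg measurableT _ mA; rewrite setTI.
split=> [J A mA|n A mA]; last exact: sameX (mgpre _ mA).
exact: (indepX J (fun i => g @^-1` A i) (fun i => mgpre _ (mA i))).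
Qed.

Lemma partial_sum_exceeds d (T : measurableType d) (Q : probability T R)
    (Y : nat -> T -> borel B) n (t : R) :
  (forall i, measurable_fun [set: T] (Y i)) -> iid Q Y ->
  Q [set w | (t < `|partial_sum Y n w|)%R] = iter n (avg Q (Y 0%N)) (exceeds t) 0%R.
Proof.
move=> mY iidY; rewrite -(integral_partial_sum separableB mY iidY); last first.
  exact: nonneg_borel_exceeds.
have mS : measurable ((partial_sum Y n : T -> borel B) @^-1`
    [set z : borel B | (t < `|(z : B)|)%R]).
  have := measurable_partial_sum separableB mY n.
  by move=> /(_ measurableT _ (measurable_exceeds_set t)); rewrite setTI.
rewrite -[X in Q X]setIT -integral_indic//.
Qed.

Lemma partial_sumB d (T : measurableType d) (X : nat -> T -> B) (v : B) n w :
  partial_sum (fun i w => X i w - v)%R n w = (partial_sum X n w - n%:R *: v)%R.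
Proof.
rewrite /partial_sum sumrB; congr (_ - _)%R.
by rewrite big_const_nat subn1 /= iter_addr addr0 scaler_nat.
Qed.

Lemma partial_sumZ d (T : measurableType d) (X : nat -> T -> B) (c : R) n w :
  partial_sum (fun i w => c *: X i w)%R n w = (c *: partial_sum X n w)%R.
Proof. by rewrite /partial_sum scaler_sumr. Qed.

Lemma measurable_norm_gt d (T : measurableType d) (u : T -> borel B) (t : R) :
  measurable_fun [set: T] u ->
  measurable [set w | (t < `|(u w : B)|)%R].
Proof.
by move=> mu; have := mu measurableT _ (measurable_exceeds_set t); rewrite setTI.
Qed.

Context d (T : measurableType d) (P : probability T R) (X : nat -> T -> borel B).
Hypothesis mX : forall i, measurable_fun [set: T] (X i).
Hypothesis iidX : iid P X.

Lemma norm_tight (u : T -> borel B) : measurable_fun [set: T] u ->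
  exists M : R, 2^-1%:E <= P [set w | (`|(u w : B)| <= M)%R].
Proof.
move=> mu; pose F k := ~` [set w | (k%:R < `|(u w : B)|)%R].
have mF k : measurable (F k) by apply: measurableC; exact: measurable_norm_gt.
have UF : \bigcup_k F k = [set: T].
  apply/seteqP; split => // w _; exists (Num.truncn `|(u w : B)|%R).+1 => //=.
  by apply/negP; rewrite -leNgt ltW// truncnS_gt.
have ndF : nondecreasing_seq F.
  move=> i j ij; apply/subsetPset => w /= /negP; rewrite -leNgt => ui.
  by apply/negP; rewrite -leNgt (le_trans ui)// ler_nat.
have : (P \o F) n @[n --> \oo] --> 1.
  by rewrite -(probability_setT P) -UF; apply: nondecreasing_cvg_mu => //; rewrite UF.
move=> /fine_cvgP[_ /cvgrPdist_lt].
have h2 : (0 < 2^-1 :> R)%R by rewrite invr_gt0.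
move=> /(_ _ h2) [N _ /(_ N (leqnn N))] /=.
rewrite ltr_distl => /andP[_ h]; exists N%:R.
have -> : [set w | (`|(u w : B)| <= N%:R)%R] = F N.
  by apply/seteqP; split => w /=; rewrite leNgt => /negP.
rewrite -(fineK (fin_num_measure P _ (mF N))) lee_fin; move: h; lra.
Qed.

(** The arbitrary centering cancels in the difference of two copies, at threshold [2 lam b_n]. A
    third [lam b_n] is spent on returning from [X - X'] to [X]: the copy is at most [M <= lam b_n]
    with probability at least 1/2. *)
Lemma tail_of_concentrated_walk (b : nat -> R) (gamma : nat -> B) (lam : R) :
  (0 < lam)%R -> (b n @[n --> \oo] --> +oo)%R ->
  P [set w | (lam * b n < `|partial_sum X n w - gamma n|)%R] @[n --> \oo] --> 0 ->
  n%:R%:E * norm_tail P (X 0%N) (3 * lam * b n) @[n --> \oo] --> 0.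
Proof.
move=> lam0 bcvg; pose A n := [set w | (lam * b n < `|partial_sum X n w - gamma n|)%R].
have mA n : measurable (A n).
  apply: (@measurable_norm_gt _ _ (fun w => (partial_sum X n w - gamma n)%R)).
  apply: measurable_subB => //.
  exact: measurable_partial_sum.
move=> /cvge0P Acvg; apply/cvge0P => [n|e e0]; first by rewrite mule_ge0.
have {}Acvg := Acvg (fun n => measure_ge0 _ _).
(* The symmetrized sum exceeds with probability at most [2 delta], doubled to [4 delta <= 1/2] by
   the Levy-type bound. Then [n q <= 8 delta], and desymmetrization gives [n r <= 16 delta <= e]. *)
pose delta := Num.min 8^-1%R (e / 16)%R.
have delta0 : (0 < delta)%R by rewrite lt_min; apply/andP; split; lra.
have delta8 : (delta <= 8^-1)%R by rewrite ge_min lexx.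
have deltae : (16 * delta <= e)%R.
  have : (delta <= e / 16)%R by rewrite ge_min lexx orbT.
  lra.
have [M MP] := norm_tight (mX 0%N).
near=> n.
have An : P (A n) <= delta%:E by near: n; exact: Acvg.
have Mb : (M <= lam * b n)%R.
  by rewrite mulrC -ler_pdivrMr//; near: n; move/cvgryPge : bcvg; exact.
pose Z i (p : T * T) : borel B := (X i p.1 - X i p.2)%R.
have mZ i : measurable_fun [set: T * T] (Z i).
  by apply: measurable_subB => //; exact: (measurableT_comp (mX i)).
have iidZ : iid (P \x P) Z.
  apply: (iid_independent_copies mX iidX (h := fun p => (p.1 - p.2)%R : borel B)).
  exact: measurable_subB.
have SZ p : (partial_sum Z n p = partial_sum X n p.1 - partial_sum X n p.2)%R.
  by rewrite /partial_sum /Z -sumrB.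
have GA : iter n (avg (P \x P) (Z 0%N)) (exceeds (2 * (lam * b n))) 0%R <= (2 * delta)%:E.
  rewrite -partial_sum_exceeds//.
  apply: (@le_trans _ _ ((P \x P) (A n `*` setT `|` setT `*` A n))).
    apply: le_measure; rewrite ?inE.
    - by apply: measurable_norm_gt; exact: measurable_partial_sum.
    - by apply: measurableU; exact: measurableX.
    move=> p /=; rewrite SZ => h.
    have [|h1] := ltP (lam * b n)%R `|partial_sum X n p.1 - gamma n|%R; first by left.
    right; split => //=; rewrite /A /= ltNge; apply/negP => h2; move: h.
    rewrite ltNge => /negP; apply.
    rewrite -(subrK (gamma n) (partial_sum X n p.1)) -addrA.
    rewrite (le_trans (ler_normD _ _))// (distrC (gamma n)); lra.
  apply: (le_trans (measureU2 _ _ _)); [exact: measurableX..|].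
  have h1 : (P \x P) (A n `*` setT) <= delta%:E.
    by rewrite product_measure1E// -[leRHS]mule1 -(probability_setT P) lee_wpmul2r.
  have h2 : (P \x P) (setT `*` A n) <= delta%:E.
    by rewrite product_measure1E// -[leRHS]mul1e -(probability_setT P) lee_wpmul2l.
  by rewrite mulr_natl mulr2n EFinD; exact: leeD h1 h2.
pose q := fine ((P \x P) [set p | (2 * (lam * b n) < `|(Z 0%N p : B)|)%R]).
have mq : measurable [set p | (2 * (lam * b n) < `|(Z 0%N p : B)|)%R].
  by have := mZ 0%N measurableT _ (measurable_exceeds_set (2 * (lam * b n))); rewrite setTI.
have qE : (P \x P) [set p | (2 * (lam * b n) < `|(Z 0%N p : B)|)%R] = q%:E.
  by rewrite fineK// (fin_num_measure ((P \x P) : probability (T * T)%type R)).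
have q01 : (0 <= q <= 1)%R.
  rewrite -!lee_fin -qE measure_ge0/=.
  exact: (probability_le1 ((P \x P) : probability (T * T)%type R)).
have sZ : sign_invariant (P \x P) (Z 0%N).
  by apply: sign_invariant_swap => // x y; rewrite opprB.
have nq : (n%:R * q <= 2 * (4 * delta))%R.
  apply: bernoulli_tail => //; first by lra.
  have := iter_avg_exceeds_of_step separableB n 0%R (mZ 0%N) sZ qE.
  move=> /le_trans/(_ (leeD GA GA)); rewrite -EFinD lee_fin; lra.
pose r := fine (P [set w | (3 * lam * b n < `|(X 0%N w : B)|)%R]).
have mr : measurable [set w | (3 * lam * b n < `|(X 0%N w : B)|)%R].
  exact: measurable_norm_gt.
have rE : norm_tail P (X 0%N) (3 * lam * b n) = r%:E.
  by rewrite /norm_tail fineK// fin_num_measure.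
have mM : measurable [set w | (`|(X 0%N w : B)| <= M)%R].
  rewrite (_ : mkset _ = ~` [set w | (M < `|(X 0%N w : B)|)%R]).
    by apply: measurableC; exact: measurable_norm_gt.
  by apply/seteqP; split => w /=; rewrite leNgt => /negP.
have r0 : (0 <= r)%R by rewrite fine_ge0.
have rq : (r * 2^-1 <= q)%R.
  rewrite -lee_fin EFinM -rE -qE.
  apply: (@le_trans _ _ (P [set w | (3 * lam * b n < `|(X 0%N w : B)|)%R] *
     P [set w | (`|(X 0%N w : B)| <= M)%R])).
    exact: lee_wpmul2l.
  rewrite -product_measure1E//; apply: le_measure; rewrite ?inE//.
    exact: measurableX.
  move=> [x y] /= [h1 h2]; rewrite /Z /=.
  have := ler_normD (X 0%N x - X 0%N y : B)%R (X 0%N y); rewrite subrK; lra.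
rewrite rE -EFinM lee_fin.
have n0 : (0 <= n%:R :> R)%R by [].
nra.
Unshelve. all: by end_near. Qed.

End RandomWalkTails.

(** * Truncation and rescaling *)

Section Truncation.
Local Open Scope ereal_scope.
Context {R : realType} {B : completeNormedModType R}.
Hypothesis separableB : separable_space B.

Lemma measurable_scaleB d (E : measurableType d) (c : R) (u : E -> borel B) :
  measurable_fun [set: E] u ->
  measurable_fun [set: E] (fun e => (c *: (u e : B))%R : borel B).
Proof.
move=> mu; apply: (measurableT_comp (measurable_fun_continuous _) mu).
exact: scaler_continuous.
Qed.

Lemma measurable_norm_le d (E : measurableType d) (u : E -> borel B) (t : R) :
  measurable_fun [set: E] u -> measurable [set e | (`|(u e : B)| <= t)%R].
Proof.
move=> mu; rewrite (_ : mkset _ = ~` [set e | (t < `|(u e : B)|)%R]).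
  by apply: measurableC; exact: measurable_norm_gt.
by apply/seteqP; split => e /=; rewrite leNgt => /negP.
Qed.

Lemma measurable_restrict0 d (E : measurableType d) (W : set E) (u : E -> borel B) :
  measurable W -> measurable_fun [set: E] u ->
  measurable_fun [set: E] (fun e => if e \in W then u e else (0%R : B)).
Proof.
move=> mW mu; apply: measurable_fun_ifT => //.
by apply: (measurable_fun_bool true); rewrite setTI (_ : _ @^-1` _ = W)//;
  apply/seteqP; split => e /=; [move/set_mem|move/mem_set].
Qed.

(* The norms of [x] and [y] select the first index [k] such that both are at
   most [b k]; rescaling by [a k / b k] turns the norming sequence [b] into
   [a]. *)
Variables a b : nat -> R.
Hypothesis a_gt0 : forall n, (1 <= n)%N -> (0 < a n)%R.
Hypothesis b_gt0 : forall n, (1 <= n)%N -> (0 < b n)%R.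
Hypothesis a_nd : forall m n, (1 <= m)%N -> (m <= n)%N -> (a m <= a n)%R.
Hypothesis b_nd : forall m n, (1 <= m)%N -> (m <= n)%N -> (b m <= b n)%R.
Hypothesis ba_nd : forall m n, (1 <= m)%N -> (m <= n)%N -> (b m / a m <= b n / a n)%R.
Hypothesis b_unbounded : forall t : R, exists k, (0 < k)%N && (t <= b k)%R.

Definition level (t : R) : nat := ex_minn (b_unbounded t).

Lemma levelP t : (0 < level t)%N /\ (t <= b (level t))%R.
Proof. by rewrite /level; case: ex_minnP => k /andP[]. Qed.

Lemma level_le t k : (level t <= k)%N = (0 < k)%N && (t <= b k)%R.
Proof.
apply/idP/idP => [lk|]; last by rewrite /level; case: ex_minnP => j _; exact.
have [l0 tl] := levelP t; rewrite (leq_trans l0 lk)/=.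
exact: le_trans tl (b_nd l0 lk).
Qed.

(** The division by 2 compensates the bound [2 b k] on the difference, so that the result has norm
    at most [a k]. The level is symmetric in the two coordinates, so exchanging them changes just
    the sign. *)
Definition rescale (p : borel B * borel B) : borel B :=
  let k := level (Num.max `|p.1 : B| `|p.2 : B|)%R in
  (a k / b k / 2 *: (p.1 - p.2 : B))%R.

Lemma rescale_swap x y : rescale (y, x) = (- (rescale (x, y) : B))%R.
Proof. by rewrite /rescale /= maxC -scalerN opprB. Qed.

(** On each of the countably many sets of constant level the map is a fixed multiple of the
    difference. *)
Lemma measurable_rescale : measurable_fun [set: borel B * borel B] rescale.
Proof.
pose m (p : borel B * borel B) := Num.max `|(p.1 : B)|%R `|(p.2 : B)|%R.
pose L k := [set p : borel B * borel B | (level (m p) <= k)%N].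
have mL k : measurable (L k).
  case: (posnP k) => [->|k0].
    rewrite (_ : L _ = set0)//; apply/seteqP; split => // p /=.
    by rewrite /L /= level_le.
  rewrite (_ : L k = [set p : borel B * borel B | (`|(p.1 : B)| <= b k)%R] `&`
                     [set p : borel B * borel B | (`|(p.2 : B)| <= b k)%R]).
    by apply: measurableI; exact: measurable_norm_le.
  apply/seteqP; split => p; rewrite /L /= level_le k0 /= /m ge_max.
    by move=> /andP.
  by move=> /andP.
pose E k := [set p : borel B * borel B | level (m p) = k].
have mE k : measurable (E k).
  rewrite (_ : E k = L k `\` \bigcup_(j in [set j | (j < k)%N]) L j).
    by apply: measurableD => //; apply: bigcup_measurable.
  apply/seteqP; split => p /=.
    rewrite /E /= => pk; split; first by rewrite /L /= pk.
    by move=> [j /= jk]; rewrite /L /= pk leqNgt jk.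
  rewrite /L /E /= => -[pk H]; apply/eqP; rewrite eqn_leq pk/= leqNgt.
  by apply/negP => lk; apply: H; exists (level (m p)) => //=.
have UE : \bigcup_k E k = [set: borel B * borel B].
  by apply/seteqP; split => // p _; exists (level (m p)).
rewrite -UE; apply/(measurable_fun_bigcup _ mE) => k.
apply: (@eq_measurable_fun _ _ _ _ _
  (fun p : borel B * borel B => (a k / b k / 2 *: (p.1 - p.2 : B))%R : borel B)).
  by move=> p; rewrite inE /E /= => pk; rewrite /rescale -/(m p) pk.
by apply: measurable_funTS; apply: measurable_scaleB; exact: measurable_subB.
Qed.

Lemma rescale_le n (x y : B) : (1 <= n)%N ->
  (`|x| <= b n)%R -> (`|y| <= b n)%R -> (`|rescale (x, y) : B| <= a n)%R.
Proof.
move=> n1 xb yb; rewrite /rescale /=; set t := Num.max _ _.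
have [k0 tk] := levelP t.
have kn : (level t <= n)%N by rewrite level_le n1 /= ge_max xb yb.
move: (level t) k0 tk kn => k k0; rewrite ge_max => /andP[xk yk] kn.
have ak := a_gt0 k0; have bk := b_gt0 k0.
apply: le_trans (a_nd k0 kn).
rewrite normrZ ger0_norm; last by rewrite !divr_ge0// ltW.
have xy : (`|x - y| <= 2 * b k)%R.
  by rewrite (le_trans (ler_normB _ _))// mulr_natl mulr2n lerD.
apply: (le_trans (ler_wpM2l _ xy)); first by rewrite !divr_ge0// ltW.
by rewrite le_eqVlt; apply/orP; left; apply/eqP; field; rewrite gt_eqF.
Qed.

Lemma rescale_contraction n (x y : B) : (1 <= n)%N ->
  (`|x| <= b n)%R -> (`|y| <= b n)%R ->
  exists2 th : R, (0 <= th <= 1)%R &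
    (x - y)%R = (th *: ((2 * b n / a n) *: (rescale (x, y) : B)))%R.
Proof.
move=> n1 xb yb; rewrite /rescale /=; set t := Num.max _ _.
have [k0 tk] := levelP t.
have kn : (level t <= n)%N by rewrite level_le n1 /= ge_max xb yb.
move: (level t) k0 {tk} kn => k k0 kn.
have ak := a_gt0 k0; have bk := b_gt0 k0.
have an := a_gt0 n1; have bn := b_gt0 n1.
(* At most 1 because [k <= n] and [b / a] is nondecreasing. *)
exists ((b k / a k) / (b n / a n))%R.
  have p1 : (0 < b k / a k)%R by rewrite divr_gt0.
  have p2 : (0 < b n / a n)%R by rewrite divr_gt0.
  by apply/andP; split; [exact/ltW/divr_gt0|rewrite ler_pdivrMr// mul1r ba_nd].
rewrite !scalerA [X in _ = (X *: _)%R](_ : _ = 1%R) ?scale1r//.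
by field; rewrite !gt_eqF.
Qed.

End Truncation.

(** * The centered weak law, part (a) *)

Section WeakLaw.
Local Open Scope ereal_scope.
Context {R : realType} {B : completeNormedModType R}.
Hypothesis separableB : separable_space B.
Variables a b : nat -> R.
Hypothesis a_gt0 : forall n, (1 <= n)%N -> (0 < a n)%R.
Hypothesis b_gt0 : forall n, (1 <= n)%N -> (0 < b n)%R.
Hypothesis a_nd : forall m n, (1 <= m)%N -> (m <= n)%N -> (a m <= a n)%R.
Hypothesis b_nd : forall m n, (1 <= m)%N -> (m <= n)%N -> (b m <= b n)%R.
Hypothesis ba_nd : forall m n, (1 <= m)%N -> (m <= n)%N -> (b m / a m <= b n / a n)%R.
Hypothesis b_cvg : (b n @[n --> \oo] --> +oo)%R.
Context d (T : measurableType d) (P : probability T R) (X : nat -> T -> borel B).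
Hypothesis mX : forall i, measurable_fun [set: T] (X i).
Hypothesis iidX : iid P X.
Hypothesis wlln_sym : forall Y : nat -> {RV (P \x P)%E >-> borel B},
  iid (P \x P) Y -> symmetric_rv (P \x P) (Y 0%N) ->
  n%:R%:E * norm_tail (P \x P) (Y 0%N) (a n) @[n --> \oo] --> 0 ->
  cvg_in_probability (P \x P)
    (fun n w => (a n)^-1 *: partial_sum Y n w)%R (fun=> 0%R).
Hypothesis tailX : n%:R%:E * norm_tail P (X 0%N) (b n) @[n --> \oo] --> 0.

Let b_unbounded (t : R) : exists k, (0 < k)%N && (t <= b k)%R.
Proof.
move/cvgryPge : b_cvg => /(_ t)[N _ HN]; exists N.+1 => /=.
exact: HN (leqnSn N).
Qed.

Let H i (p : T * T) : borel B := rescale a b_unbounded (X i p.1, X i p.2).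

Let mpair i : measurable_fun [set: T * T] (fun p => (X i p.1, X i p.2)).
Proof. by apply/measurable_fun_pair; exact: (measurableT_comp (mX i)). Qed.

Let mH i : measurable_fun [set: T * T] (H i).
Proof. exact: (measurableT_comp (measurable_rescale separableB a b_nd b_unbounded)). Qed.

Let PP : probability (T * T)%type R := (P \x P)%E.

Let large n := [set p : T * T | (b n < `|(X 0%N p.1 : B)|)%R] `|`
               [set p : T * T | (b n < `|(X 0%N p.2 : B)|)%R].

Let mlarge n : measurable (large n).
Proof.
by apply: measurableU; apply: measurable_norm_gt; exact: (measurableT_comp (mX 0%N)).
Qed.

Let large_le n : PP (large n) <= 2%:E * norm_tail P (X 0%N) (b n).
Proof.
have mt : measurable [set w | (b n < `|(X 0%N w : B)|)%R] by exact: measurable_norm_gt.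
apply: (le_trans (measureU2 _ _ _)).
- by apply: measurable_norm_gt; exact: (measurableT_comp (mX 0%N)).
- by apply: measurable_norm_gt; exact: (measurableT_comp (mX 0%N)).
have e1 : PP [set p : T * T | (b n < `|(X 0%N p.1 : B)|)%R] = norm_tail P (X 0%N) (b n).
  rewrite /norm_tail -[RHS]mule1 -(probability_setT P) -product_measure1E//.
  by congr ((P \x P) _); apply/seteqP; split => p //= -[].
have e2 : PP [set p : T * T | (b n < `|(X 0%N p.2 : B)|)%R] = norm_tail P (X 0%N) (b n).
  rewrite /norm_tail -[RHS]mul1e -(probability_setT P) -product_measure1E//.
  by congr ((P \x P) _); apply/seteqP; split => p //= -[].
by rewrite mule_natl mule2n; apply: leeD; [rewrite -e1|rewrite -e2].
Qed.

Let small n p : ~ large n p ->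
  (`|X 0%N p.1 : B| <= b n)%R /\ (`|X 0%N p.2 : B| <= b n)%R.
Proof. by move=> /not_orP[/negP + /negP]; rewrite -!leNgt. Qed.

Let H_tail n : (1 <= n)%N ->
  n%:R%:E * norm_tail PP (H 0%N) (a n) <= 2%:E * (n%:R%:E * norm_tail P (X 0%N) (b n)).
Proof.
move=> n1; rewrite muleCA lee_wpmul2l//; apply: le_trans (large_le n).
apply: le_measure; rewrite ?inE//; first exact: measurable_norm_gt.
move=> p /= ap; apply: contrapT => /small[h1 h2].
have := rescale_le a_gt0 b_gt0 a_nd b_nd b_unbounded n1 h1 h2.
by rewrite leNgt ap.
Qed.

Let tail_ge0 n : 0 <= n%:R%:E * norm_tail P (X 0%N) (b n).
Proof. by rewrite mule_ge0. Qed.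

Let tail_small (e : R) : (0 < e)%R ->
  \forall n \near \oo, n%:R%:E * norm_tail P (X 0%N) (b n) <= e%:E.
Proof. by move/cvge0P : tailX => /(_ tail_ge0); exact. Qed.

Let signH (u : borel B -> borel B) : measurable_fun [set: borel B] u ->
  (forall x : B, u (- x)%R = (- (u x : B))%R) -> sign_invariant PP (fun p => u (H 0%N p)).
Proof.
move=> mu uN; apply: sign_invariant_swap => //; first exact: (measurableT_comp mu).
by move=> x y; rewrite /H/= rescale_swap uN.
Qed.

Let symmetrized_sum_small (e t : R) : (0 < e)%R -> (0 < t)%R ->
  \forall n \near \oo,
    iter n (avg PP (fun p => (2 * b n / a n *: (H 0%N p : B))%R)) (exceeds (t * b n)) 0%R
    <= e%:E.
Proof.
move=> e0 t0.
have iidH : iid PP H.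
  exact: (iid_independent_copies mX iidX (measurable_rescale separableB a b_nd b_unbounded)).
(* Symmetry in law is sign invariance tested on indicators at the origin. *)
have symH : symmetric_rv PP (H 0%N).
  move=> A mA.
  have mH0 : measurable_fun [set: T * T] (H 0%N) by [].
  pose f : B -> \bar R := fun x => (\1_A x)%:E.
  have bf : nonneg_borel f.
    split => [|x]; last by rewrite lee_fin.
    by apply/measurable_EFinP; exact: measurable_indic.
  have mpre (u : T * T -> borel B) : measurable_fun [set: T * T] u -> measurable (u @^-1` A).
    by move=> mu; have := mu measurableT _ mA; rewrite setTI.
  have PE (u : T * T -> borel B) : measurable_fun [set: T * T] u ->
      PP (u @^-1` A) = avg PP u f 0%R.
    move=> mu; rewrite -[X in PP X]setIT -integral_indic//; last exact: mpre.
    by apply: eq_integral => p _; rewrite add0r /f !indicE.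
  rewrite PE// PE; last exact: measurable_opp.
  by apply: (signH (u := id)).
have := @wlln_sym (fun i => mfun_of (mH i)) iidH symH.
have cH : n%:R%:E * norm_tail PP (H 0%N) (a n) @[n --> \oo] --> 0.
  apply/cvge0P => [n|e' e'0]; first by rewrite mule_ge0.
  near=> n; have n1 : (1 <= n)%N by near: n; exact: nbhs_infty_ge.
  apply: (le_trans (H_tail n1)).
  rewrite (_ : e' = 2 * (e' / 2))%R; last by field.
  rewrite EFinM lee_wpmul2l//; near: n; apply: tail_small.
  by rewrite divr_gt0.
(* Multiplying the sum by [2 b_n / a_n] turns the threshold [t / 2] relative to [a n] into
   [t * b n]. *)
move=> /(_ cH (t / 2)%R (divr_gt0 t0 (ltr0n R 2))) /cvge0P.
move=> /(_ (fun n => measure_ge0 _ _) e e0) He.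
near=> n; have n1 : (1 <= n)%N by near: n; exact: nbhs_infty_ge.
have an := a_gt0 n1; have bn := b_gt0 n1.
have mKH i : measurable_fun [set: T * T] (fun p => (2 * b n / a n *: (H i p : B))%R : borel B).
  exact: measurable_scaleB.
have iidKH : iid PP (fun i p => (2 * b n / a n *: (H i p : B))%R : borel B).
  by apply: (iid_comp (g := fun x => (2 * b n / a n *: (x : B))%R : borel B)) => //;
    exact: measurable_scaleB.
rewrite -(partial_sum_exceeds separableB n (t * b n) mKH iidKH).
apply: (@le_trans _ _ (PP [set w | (t / 2 < `|(a n)^-1 *: partial_sum H n w - 0|)%R])); last first.
  by near: n; exact: He.
apply: le_measure; rewrite ?inE.
- by apply: measurable_norm_gt; exact: measurable_partial_sum.
- apply: (@measurable_norm_gt _ _ _ _ (fun w => (a n)^-1 *: partial_sum H n w - 0)%R).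
  apply: measurable_subB => //; apply: measurable_scaleB.
  exact: measurable_partial_sum.
have K0 : (0 < 2 * b n / a n)%R by rewrite divr_gt0// mulr_gt0.
have ai0 : (0 < (a n)^-1)%R by rewrite invr_gt0.
move=> p /=; rewrite partial_sumZ subr0 (normrZ (2 * b n / a n)) (normrZ (a n)^-1)
  (gtr0_norm K0) (gtr0_norm ai0).
move: `|partial_sum H n p|%R => s h.
have -> : ((a n)^-1 * s = (2 * b n / a n * s) / (2 * b n))%R by field; rewrite !gt_eqF.
rewrite ltr_pdivlMr ?mulr_gt0//.
by have -> : (t / 2 * (2 * b n) = t * b n)%R by field.
Unshelve. all: by end_near. Qed.

Let U n (w : T) : borel B := (\1_[set w' | (`|X 0%N w' : B| <= b n)%R] w *: (X 0%N w : B))%R.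

Let UE n w : U n w = if (`|(X 0%N w : B)| <= b n)%R then X 0%N w else 0%R.
Proof.
rewrite /U indicE; case: ifPn => h; first by rewrite mem_set//= scale1r.
by rewrite memNset ?scale0r//=; exact/negP.
Qed.

Let mU n : measurable_fun [set: T] (U n).
Proof.
rewrite (_ : U n = fun w => if w \in [set w' | (`|(X 0%N w' : B)| <= b n)%R] then X 0%N w
  else (0%R : B)).
  by apply: measurable_restrict0 => //; exact: measurable_norm_le.
apply/funext => w; rewrite UE; case: ifPn => h; first by rewrite mem_set.
by rewrite memNset//=; exact/negP.
Qed.

Let U_le n w : (1 <= n)%N -> (`|U n w : B| <= b n)%R.
Proof. by move=> n1; rewrite UE; case: ifP => // _; rewrite normr0 ltW// b_gt0. Qed.

(** Three walks are compared: [phi], the scaled [H] cut at [a n], bounded by [2 b_n]; [D], a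
    contraction of [phi]; and the symmetrized truncation, close to [D] in mean. The first
    contributes [2 t b_n + 4 (2 b_n) p], the last exchange [4 b_n] times the scaled tail. *)
Let truncated_walk_bound n (t p : R) : (1 <= n)%N -> (0 <= t)%R -> (p <= 4^-1)%R ->
  iter n (avg PP (fun p => (2 * b n / a n *: (H 0%N p : B))%R)) (exceeds (t * b n)) 0%R +
    n%:R%:E * norm_tail PP (H 0%N) (a n) <= p%:E ->
  iter n (avg PP (fun p => U n p.1 - U n p.2)%R) (@norm_ereal R B) 0%R <=
  (b n)%:E * ((2 * t + 8 * p)%:E + 4%:E * (n%:R%:E * norm_tail P (X 0%N) (b n))).
Proof.
move=> n1 t0 p4 Hp; have an := a_gt0 n1; have bn := b_gt0 n1.
have bN := @nonneg_borel_norm R B.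
pose K := (2 * b n / a n)%R; have K0 : (0 < K)%R by rewrite divr_gt0// mulr_gt0.
pose cut (x : borel B) : borel B :=
  if x \in [set x : borel B | (`|(x : B)| <= a n)%R] then (K *: (x : B))%R else 0%R.
have mcut : measurable_fun [set: borel B] cut.
  by apply: measurable_restrict0; [exact: measurable_norm_le|exact: measurable_scaleB].
have cutE x : cut x = if (`|(x : B)| <= a n)%R then (K *: (x : B))%R else 0%R.
  by rewrite /cut; case: ifPn => [/set_mem/= ->//|]; rewrite notin_setE/= => /negP/negbTE ->.
have cutN (x : B) : cut (- x)%R = (- (cut x : B))%R.
  by rewrite !cutE normrN; case: ifP => _; rewrite ?oppr0// scalerN.
pose phi p := cut (H 0%N p).
have mphi : measurable_fun [set: T * T] phi by exact: (measurableT_comp mcut).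
have sphi : sign_invariant PP phi by exact: signH.
have phib q : (`|phi q : B| <= 2 * b n)%R.
  rewrite /phi cutE; case: ifP => [h|_]; last by rewrite normr0 mulr_ge0// ltW.
  rewrite normrZ gtr0_norm// (le_trans (ler_wpM2l (ltW K0) h))//.
  by rewrite /K mulfVK// gt_eqF.
have phip : iter n (avg PP phi) (exceeds (t * b n)) 0%R <= p%:E.
  apply: le_trans Hp; apply: iter_avg_replace_event => //.
  - exact: measurable_scaleB.
  - exact: measurable_norm_gt.
  - exact: nonneg_borel_exceeds.
  - by move=> x; rewrite exceedsE lee_fin lern1 leq_b1.
  - by move=> q /= /negP; rewrite -leNgt /phi cutE => ->.
have b20 : (0 <= 2 * b n)%R by rewrite mulr_ge0// ltW.
have tb0 : (0 <= t * b n)%R by rewrite mulr_ge0// ltW.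
have := iter_avg_norm_bound separableB mphi sphi b20 tb0 phib p4 phip.
(* [D] vanishes as soon as one coordinate is large, so it is always a multiple of [phi]. It differs
   from the difference of truncations only on [large n], and there by at most [2 b_n]. *)
pose D q : borel B := if q \in ~` large n then (X 0%N q.1 - X 0%N q.2 : B)%R else 0%R.
have mXX : measurable_fun [set: T * T] (fun q => (X 0%N q.1 - X 0%N q.2)%R : borel B).
  by apply: measurable_subB => //; exact: (measurableT_comp (mX 0%N)).
have mD : measurable_fun [set: T * T] D.
  by apply: measurable_restrict0 => //; exact: measurableC.
have /choice[th thP] : forall q, exists th : R,
    (0 <= th <= 1)%R /\ D q = (th *: (phi q : B))%R.
  move=> q; rewrite /D; case: ifPn => [/set_mem/small[h1 h2]|_]; last first.
    by exists 0%R; rewrite lexx ler01 scale0r.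
  have [th th01 thE] := rescale_contraction a_gt0 b_gt0 b_nd ba_nd b_unbounded n1 h1 h2.
  exists th; split => //; rewrite /phi cutE.
  by rewrite (rescale_le a_gt0 b_gt0 a_nd b_nd b_unbounded n1 h1 h2).
have sD : sign_invariant PP D.
  apply: sign_invariant_swap => // x y; rewrite /D.
  rewrite (_ : ((y, x) \in _) = ((x, y) \in ~` large n)).
    by case: ifP => _; rewrite ?oppr0// opprB.
  by apply/idP/idP; rewrite !inE /large /= => h [] ?; apply: h; [right|left|right|left].
have Dphi := iter_avg_contraction separableB n 0%R mphi mD sphi sD
  (fun q => (thP q).1) (fun q => (thP q).2) bN (@spread_increasing_norm R B).
have mUU : measurable_fun [set: T * T] (fun q => (U n q.1 - U n q.2)%R : borel B).
  by apply: measurable_subB => //; exact: (measurableT_comp (mU n)).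
have UD q : `|(U n q.1 - U n q.2 : B) - D q|%R%:E <= (2 * b n)%:E * (\1_(large n) q)%:E.
  rewrite indicE /D; have [ql|ql] := boolP (q \in large n).
    rewrite ifF; last by rewrite in_setC ql.
    rewrite mule1 subr0 lee_fin (le_trans (ler_normB _ _))// mulr_natl mulr2n.
    by rewrite lerD// U_le.
  rewrite in_setC ql mule0; move: ql; rewrite notin_setE => /small[h1 h2].
  by rewrite !UE h1 h2 subrr normr0.
have mUD : measurable_fun [set: T * T] (fun q => `|(U n q.1 - U n q.2 : B) - D q|%R%:E).
  exact: measurable_normB.
have intUD : \int[PP]_q `|(U n q.1 - U n q.2 : B) - D q|%R%:E <=
    (4 * b n)%:E * norm_tail P (X 0%N) (b n).
  apply: (@le_trans _ _ ((2 * b n)%:E * PP (large n))); last first.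
    rewrite (_ : 4 * b n = 2 * b n * 2)%R; last by ring.
    by rewrite (EFinM (2 * b n)) -muleA lee_wpmul2l// ?lee_fin//; exact: large_le.
  rewrite -[X in PP X]setIT -(integral_indic _ measurableT)// -ge0_integralZl_EFin//.
    apply: ge0_le_integral => //.
    by apply: measurable_funeM; apply/measurable_EFinP; exact: measurable_indic.
  by apply/measurable_EFinP; exact: measurable_indic.
have tfin : norm_tail P (X 0%N) (b n) \is a fin_num.
  by rewrite fin_num_measure//; exact: measurable_norm_gt.
have intfin : \int[PP]_q `|(U n q.1 - U n q.2 : B) - D q|%R%:E \is a fin_num.
  rewrite ge0_fin_numE; last by apply: integral_ge0.
  apply: (le_lt_trans intUD); rewrite -(fineK tfin) -EFinM; exact: ltry.
have := iter_avg_replace_lipschitz separableB n 0%R mUU mD bN (@lipschitz1_norm R B) intfin.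
move=> h1 h2; apply: (le_trans h1).
apply: (le_trans (leeD (le_trans Dphi h2) (lee_wpmul2l _ intUD))) => //.
have [r tE] : exists r : R, norm_tail P (X 0%N) (b n) = r%:E.
  by exists (fine (norm_tail P (X 0%N) (b n))); rewrite fineK.
rewrite tE -!EFinM -!EFinD lee_fin.
by rewrite le_eqVlt; apply/orP; left; apply/eqP; ring.
Qed.

Let symmetrized_truncated_walk_small (e : R) : (0 < e)%R ->
  \forall n \near \oo,
    iter n (avg PP (fun p => U n p.1 - U n p.2)%R) (@norm_ereal R B) 0%R <= (e * b n)%:E.
Proof.
(* With [t = e / 8], the bound [2 t + 8 p + 4 (e / 16)] is at most [3 e / 4]. The two parts of the
   probability budget are [p / 2] each; [H_tail] doubles the tail, hence [p / 4]. *)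
move=> e0; pose p := Num.min 4^-1%R (e / 32)%R.
have p0 : (0 < p)%R by rewrite lt_min; apply/andP; split; lra.
have p4 : (p <= 4^-1)%R by rewrite ge_min lexx.
have pe : (p <= e / 32)%R by rewrite ge_min lexx orbT.
have p20 : (0 < p / 2)%R by lra.
have e8 : (0 < e / 8)%R by lra.
have p40 : (0 < p / 4)%R by lra.
have e16 : (0 < e / 16)%R by lra.
near=> n; have n1 : (1 <= n)%N by near: n; exact: nbhs_infty_ge.
have h1 : iter n (avg PP (fun p => (2 * b n / a n *: (H 0%N p : B))%R))
    (exceeds (e / 8 * b n)) 0%R <= (p / 2)%:E.
  by near: n; exact: symmetrized_sum_small.
have h2 : n%:R%:E * norm_tail P (X 0%N) (b n) <= (p / 4)%:E by near: n; exact: tail_small.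
have h3 : n%:R%:E * norm_tail P (X 0%N) (b n) <= (e / 16)%:E by near: n; exact: tail_small.
have h4 : n%:R%:E * norm_tail PP (H 0%N) (a n) <= (p / 2)%:E.
  apply: (le_trans (H_tail n1)); rewrite (_ : p / 2 = 2 * (p / 4))%R; last by field.
  by rewrite EFinM lee_wpmul2l.
apply: (le_trans (truncated_walk_bound n1 (ltW e8) p4 _)).
  by apply: (le_trans (leeD h1 h4)); rewrite -EFinD lee_fin; lra.
rewrite (mulrC e (b n)) (EFinM (b n) e); apply: lee_wpmul2l; first by rewrite lee_fin ltW// b_gt0.
apply: (@le_trans _ _ ((2 * (e / 8) + 8 * p)%:E + 4%:E * (e / 16)%:E)).
  by rewrite leeD2l// lee_wpmul2l.
by rewrite -EFinM -EFinD lee_fin; lra.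
Unshelve. all: by end_near. Qed.

(** Truncating the summands costs [n P(|X| > b_n)] in probability. The centered truncated walk is
    then handled by Markov's inequality and the mean bound for its symmetrization. *)
Lemma weak_law_centered :
  cvg_in_probability P
    (fun n w => (b n)^-1 *: (partial_sum X n w - truncated_mean P (X 0%N) b n))%R
    (fun=> 0%R).
Proof.
move=> lam lam0; apply/cvge0P => // e e0.
have e20 : (0 < e / 2)%R by lra.
have le20 : (0 < lam * (e / 2))%R by rewrite mulr_gt0.
near=> n; have n1 : (1 <= n)%N by near: n; exact: nbhs_infty_ge.
have bn := b_gt0 n1; have lb : (0 < lam * b n)%R by rewrite mulr_gt0.
have h1 : n%:R%:E * norm_tail P (X 0%N) (b n) <= (e / 2)%:E by near: n; exact: tail_small.
have h2 : iter n (avg PP (fun p => U n p.1 - U n p.2)%R) (@norm_ereal R B) 0%R <=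
    (lam * (e / 2) * b n)%:E by near: n; exact: symmetrized_truncated_walk_small.
pose v := bochner_expectation P (U n).
have vP : is_bochner_integral P (U n) v.
  have [v0 v0P] := bochner_integral_exists separableB P (mU n) (fun w => U_le w n1).
  (* Boundedness of the truncation guarantees that the expectation is a genuine integral and not the
     default value 0. *)
  by apply: (@xgetPex _ 0%R [set v | is_bochner_integral P (U n) v]); exists v0.
have mXv i : measurable_fun [set: T] (fun w => (X i w - v)%R : borel B).
  by apply: measurable_subB.
have mUv : measurable_fun [set: T] (fun w => (U n w - v)%R : borel B).
  by apply: measurable_subB.
have iidXv : iid P (fun i w => (X i w - v)%R : borel B).
  apply: (iid_comp (g := fun x => (x - v)%R : borel B)) => //.
  exact: measurable_subB.
have -> : [set w | (lam < `|(b n)^-1 *: (partial_sum X n w - truncated_mean P (X 0%N) b n) - 0|)%R]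
    = [set w | (lam * b n < `|partial_sum (fun i w => X i w - v)%R n w|)%R].
  apply/seteqP; split => w /=; rewrite subr0 normrZ gtr0_norm ?invr_gt0//
    (mulrC _ `|_|%R) ltr_pdivlMr// partial_sumB //.
rewrite (partial_sum_exceeds separableB n (lam * b n) mXv iidXv).
have mt : measurable [set w | (b n < `|(X 0%N w : B)|)%R] by exact: measurable_norm_gt.
have exceeds1 (x : B) : exceeds (lam * b n) x <= 1.
  by rewrite exceedsE lee_fin lern1 leq_b1.
have XUv w : ~ (b n < `|(X 0%N w : B)|)%R -> (X 0%N w - v = U n w - v :> B)%R.
  by move=> /negP; rewrite -leNgt UE => ->.
apply: (le_trans (iter_avg_replace_event separableB P n 0%R (mXv 0%N) mUv mt
  (@nonneg_borel_exceeds R B _) exceeds1 XUv)).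
rewrite (_ : e = e / 2 + e / 2)%R; last by field.
rewrite EFinD leeD//.
have bN := @nonneg_borel_norm R B.
have il0 : (0 <= (lam * b n)^-1)%R by rewrite invr_ge0 ltW.
(* Markov's inequality: the indicator is dominated by the norm divided by [lam * b n]. *)
apply: (@le_trans _ _ (iter n (avg P (fun w => (U n w - v)%R))
    (fun x => (lam * b n)^-1%:E * norm_ereal x) 0%R)).
  apply: le_iter_avg => //; first exact: nonneg_borel_exceeds.
    exact: nonneg_borelZ.
  move=> x; rewrite exceedsE /norm_ereal -EFinM lee_fin (mulrC _ `|x|%R).
  by case: ltP => /= h; [rewrite ler_pdivlMr// mul1r ltW|rewrite divr_ge0// ltW].
rewrite iter_avgZ//.
have h3 := iter_avg_centered separableB n 0%R (mU n)
  (fun x => bochner_integral_jensen separableB x vP).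
apply: (le_trans (lee_wpmul2l _ (le_trans h3 h2))); first by rewrite lee_fin.
rewrite -EFinM lee_fin le_eqVlt; apply/orP; left; apply/eqP.
by field; rewrite !gt_eqF.
Unshelve. all: by end_near. Qed.

End WeakLaw.

(** * Conclusion: parts (a) and (b) *)

Unset Implicit Arguments.

Theorem theorem3p1 (R : realType) (B : completeNormedModType R)
    (separableB : separable_space B)
    (a b : nat -> R)
    (a_gt0 : forall n, (1 <= n)%N -> 0 < a n)
    (b_gt0 : forall n, (1 <= n)%N -> 0 < b n)
    (a_incr : forall m n, (1 <= m)%N -> (m < n)%N -> a m < a n)
    (b_incr : forall m n, (1 <= m)%N -> (m < n)%N -> b m < b n)
    (a_cvg : a n @[n --> \oo] --> +oo)
    (ba_nondecr : forall m n, (1 <= m)%N -> (m <= n)%N ->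
       b m / a m <= b n / a n)
    (wlln_sym : forall (d : measure_display) (T : measurableType d)
        (P : probability T R) (X : nat -> {RV P >-> borel B}),
      iid P X -> symmetric_rv P (X 0%N) ->
      cvg_in_probability P
        (fun n w => (a n)^-1 *: partial_sum X n w) (fun=> 0) <->
      ((n%:R)%:E * norm_tail P (X 0%N) (a n))%E @[n --> \oo] --> 0%E) :
  forall (d : measure_display) (T : measurableType d) (P : probability T R)
    (X : nat -> {RV P >-> borel B}),
    iid P X ->
    let S := partial_sum X in
    let gamma := truncated_mean P (X 0%N) b in
    ((n%:R%:E * norm_tail P (X 0%N) (b n))%E @[n --> \oo] --> 0%E ->
       cvg_in_probability P
         (fun n w => (b n)^-1 *: (S n w - gamma n)) (fun=> 0)) /\
    ((0 < limn_esup (fun n => n%:R%:E * norm_tail P (X 0%N) (b n)))%E ->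
       forall lambda : R, 0 < lambda ->
         (0 < limn_esup
           (fun n => P [set w | (lambda < `|S n w - gamma n| / b n)%R]))%E).
Proof.
move=> d T P X iidX S gamma.
have mX i : measurable_fun [set: T] (X i : T -> borel B) by exact: measurable_funP.
have a_nd m n : (1 <= m)%N -> (m <= n)%N -> a m <= a n.
  by move=> m1; rewrite leq_eqVlt => /orP[/eqP ->//|mn]; exact/ltW/a_incr.
have b_nd m n : (1 <= m)%N -> (m <= n)%N -> b m <= b n.
  by move=> m1; rewrite leq_eqVlt => /orP[/eqP ->//|mn]; exact/ltW/b_incr.
(* Monotonicity of the ratio gives [b n >= (b 1 / a 1) * a n]. *)
have b_cvg : b n @[n --> \oo] --> +oo.
  have r0 : 0 < b 1%N / a 1%N by rewrite divr_gt0 ?a_gt0 ?b_gt0.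
  apply/cvgryPge => A; near=> n.
  have n1 : (1 <= n)%N by near: n; exact: nbhs_infty_ge.
  have ar : A / (b 1%N / a 1%N) <= a n by near: n; move/cvgryPge : a_cvg; exact.
  have := ba_nondecr 1%N n (leqnn 1) n1; rewrite ler_pdivlMr ?a_gt0//.
  by apply: le_trans; rewrite mulrC -ler_pdivrMr.
(* A constant multiple of [b] satisfies the same conditions relative to [a]. The case [c = 1] is
   (a), and [c = 3 * lam] serves (b); the truncation level in the centering changes with [c]. *)
have weak_law (c : R) (b' : nat -> R) : 0 < c -> b' = (fun n => c * b n) ->
    (n%:R%:E * norm_tail P (X 0%N) (b' n))%E @[n --> \oo] --> 0%E ->
    cvg_in_probability P
      (fun n w => (b' n)^-1 *: (S n w - truncated_mean P (X 0%N) b' n)) (fun=> 0).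
  move=> c0 -> tailX; apply: (@weak_law_centered _ _ separableB a (fun n => c * b n)) => //.
  - by move=> n n1; rewrite mulr_gt0// b_gt0.
  - by move=> m n m1 mn; rewrite ler_pM2l// b_nd.
  - by move=> m n m1 mn; rewrite -!mulrA ler_pM2l// ba_nondecr.
  - apply/cvgryPge => A; move/cvgryPge : b_cvg => /(_ (A / c)).
    by apply: filterS => n; rewrite ler_pdivrMr// mulrC.
  - by move=> Y iidY symY; exact: (wlln_sym _ _ _ Y iidY symY).2.
split=> [tailX|limsup_gt0 lam lam0].
  by apply: (weak_law 1) => //; apply/funext => n; rewrite mul1r.
rewrite ltNge; apply/negP => limsup_le0.
have concentrated : P [set w | lam * b n < `|S n w - gamma n|] @[n --> \oo] --> 0%E.
  have : P [set w | lam < `|S n w - gamma n| / b n] @[n --> \oo] --> 0%E.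
    by apply: limn_esup_le_cvg => // n; exact: measure_ge0.
  apply: cvg_trans; apply: near_eq_cvg; near=> n.
  have n1 : (1 <= n)%N by near: n; exact: nbhs_infty_ge.
  by congr (P _); apply/seteqP; split => w /=; rewrite ltr_pdivlMr// b_gt0.
have l30 : 0 < 3 * lam by rewrite mulr_gt0.
have := weak_law (3 * lam) _ l30 erefl
  (tail_of_concentrated_walk separableB mX iidX lam0 b_cvg concentrated).
pose gamma' := truncated_mean P (X 0%N) (fun k => 3 * lam * b k).
(* Chosen so that [(9 lam)^-1 * (3 lam b_n) = b_n / 3], whose triple is exactly [b_n]. *)
move=> /(_ (9 * lam)^-1); rewrite invr_gt0 mulr_gt0// => /(_ isT) law'.
have concentrated' : P [set w | 3^-1 * b n < `|S n w - gamma' n|] @[n --> \oo] --> 0%E.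
  move: law'; apply: cvg_trans; apply: near_eq_cvg; near=> n.
  have n1 : (1 <= n)%N by near: n; exact: nbhs_infty_ge.
  have cb0 : 0 < 3 * lam * b n by rewrite mulr_gt0// b_gt0.
  congr (P _); apply/seteqP; split => w /=; rewrite subr0 normrZ gtr0_norm ?invr_gt0//
    [_^-1 * `|_|]mulrC ltr_pdivlMr// (_ : (9 * lam)^-1 * (3 * lam * b n) = 3^-1 * b n)//;
    by field; rewrite gt_eqF.
have := tail_of_concentrated_walk separableB mX iidX _ b_cvg concentrated'.
rewrite invr_gt0 => /(_ (ltr0n R 3)); under eq_fun do rewrite mulfV ?pnatr_eq0// mul1r.
(* The scaled tail at [b n] now tends to 0, against its positive upper limit. *)
move=> tail0; move: limsup_gt0; rewrite is_cvg_limn_esupE; last by apply/cvg_ex; exists 0%E.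
by rewrite (cvg_lim _ tail0)// ltxx.
Unshelve. all: by end_near. Qed.
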